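(* Let $X$ be an $s$-regular metric space, i.e. there are a measure $\nu$ on $X$ and constants $a,b>0$ with $ar^s\le\nu(B(x,r))\le br^s$ for all $x\in X$ and $0<r\le\operatorname{diam}(X)$, and let $\mu$ be a measure on $X$. Then $$\overline{\dim}_{\mathrm{loc}}(\mu,x)\le s-c\operatorname{por}_1(\mu,x)^s$$ for $\mu$-almost all $x\in X$, where $c>0$ depends only on $s$ and the constants $a$ and $b$.
   Context: Here $s>0$, $(X,d)$ is a metric space and $B(x,r)=\{y\in X:d(x,y)\le r\}$. A measure on $X$ means a nontrivial Borel regular outer measure defined on all subsets of $X$ such that bounded sets have finite measure. The upper local dimension is $\overline{\dim}_{\mathrm{loc}}(\mu,x)=\limsup_{r\downarrow0}\log\mu(B(x,r))/\log r$. For $x\in X$, $r,\varepsilon>0$, let $$\operatorname{por}_1(\mu,x,r,\varepsilon)=\sup\{\varrho\ge0:\text{there is }y\in X\text{ with }\mu(B(y,\varrho r))\le\varepsilon\mu(B(x,r))\text{ and }\varrho r+d(x,y)\le r\}$$ (with $\sup\emptyset=0$), and $\operatorname{por}_1(\mu,x)=\lim_{\varepsilon\downarrow0}\liminf_{r\downarrow0}\operatorname{por}_1(\mu,x,r,\varepsilon)$. *)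

(* Defs.v *)
From HB Require Import structures.
From mathcomp Require Export all_boot all_order all_algebra.
From mathcomp Require Export all_classical all_reals all_analysis.
Export Order.TTheory GRing.Theory Num.Theory.
Export numFieldNormedType.Exports.

Set Implicit Arguments.
Unset Strict Implicit.
Unset Printing Implicit Defensive.

Local Open Scope classical_set_scope.
Local Open Scope ring_scope.
Local Open Scope ereal_scope.

(* The library's [closed_ball] is the closure of the open ball, which in a
   general metric space may be smaller than this set. *)
Definition cball (R : realType) (X : metricType R) (x : X) (r : R) : set X :=
  [set y | (mdist x y <= r)%R].

(* [-oo] for the empty space and [+oo] for an unbounded one. *)
Definition mdiam (R : realType) (X : metricType R) : \bar R :=
  ereal_sup [set d | exists x y : X, d = (mdist x y)%:E].

Definition borel_set (R : realType) (X : metricType R) : set (set X) :=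
  <<s [set U : set X | open U] >>.

Record is_metric_measure (R : realType) (X : metricType R)
    (mu : {outer_measure set X -> \bar R}) : Prop := IsMetricMeasure {
  mm_nontrivial : 0 < mu setT ;
  mm_borel : forall A : set X, borel_set A -> mu.-caratheodory A ;
  mm_regular : forall A : set X,
    exists B : set X, [/\ borel_set B, A `<=` B & mu B = mu A] ;
  mm_bounded : forall A : set X,
    (exists (x : X) (r : R), A `<=` cball x r) -> mu A < +oo
}.

Definition regular_with (R : realType) (X : metricType R) (s a b : R)
    (nu : {outer_measure set X -> \bar R}) : Prop :=
  is_metric_measure nu /\
  forall (x : X) (r : R), (0 < r)%R -> r%:E <= mdiam X ->
    (a * r `^ s)%:E <= nu (cball x r) <= (b * r `^ s)%:E.

(* If the ball is null then [lne 0 = -oo], so the quotient is [+oo] for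
   [0 < r < 1]. *)
Definition upper_local_dim (R : realType) (X : metricType R)
    (mu : set X -> \bar R) (x : X) : \bar R :=
  limf_esup (fun r : R => lne (mu (cball x r)) * ((ln r)^-1)%:E) 0%R^'+.

(* The real-valued [sup] is 0 on the empty set. The set below is bounded by 1
   as [0 < r], so the convention for unbounded sets plays no role. *)
Definition por1_at (R : realType) (X : metricType R)
    (mu : set X -> \bar R) (x : X) (r eps : R) : R :=
  sup [set rho : R | (0 <= rho)%R /\
    exists y : X, mu (cball y (rho * r)) <= eps%:E * mu (cball x r) /\
                  (rho * r + mdist x y <= r)%R].

(* The limit exists: the liminf is nondecreasing in [eps]. *)
Definition por1 (R : realType) (X : metricType R)
    (mu : set X -> \bar R) (x : X) : \bar R :=
  lim (limf_einf (fun r : R => (por1_at mu x r eps)%:E) 0%R^'+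
       @[eps --> 0%R^'+]).

(* Main.v *)
Require Import Defs.
From mathcomp Require Import ring lra zify.

(** Fix a porosity scale [2 ^- k] and, for a small [eps], call [y] a hole
    centre of level [m] if the ball about [y] of radius [2 rho_m] carries at
    most the fraction [eps] of the mass of the concentric ball of radius
    [2 rho_(m - k)], where [rho_m = r0 / 2 ^ m].  Around a point of porosity
    larger than about [4 * 2 ^- k], every small ball of radius [rho_n] contains
    a hole centre of level [n + k].  Three facts give the theorem.

    1. Counting against [nu] (lemma [weight_sum_le]).  Let [weight n z] be the
    product over the levels below [n] of a factor about [1 + beta] if [z] is
    close, at that level, to a hole [k] levels deeper, and of a factor about
    [1 / 2] if [z] lies in a hole of that level.  With [beta] a small multiple
    of [2 ^- (k s)], the sum of the weights over a net of scale [rho_N] does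
    not exceed the number of points of the net: what is gained by being close
    to a hole is paid for by what is lost inside holes.  The important case is
    that of one hole seen from many scales, which naively would cost a factor
    [k], that is, the logarithm of the porosity.  It is avoided by charging a
    point to the outermost hole near its own hole: up to the level of that
    hole the weight there has not dropped, and a hole of level [m] is
    charged from level [n] by a region whose measure is at most
    [2 ^ ((m - n) s)] times larger, a geometric sum dominated by [2 ^ (k s)].

    2. A Borel-Cantelli argument (lemma [ae_weighted_mass]).  As the net has
    at most [C * 2 ^ (N s)] points, points near which the mass is below
    [weight * 2 ^- (N (s + delta))] form a set of summable measure, so almost
    every [x] has eventually at least that mass in its ball of radius [rho_N].
    With the weight [1] this bounds the upper local dimension by [s].

    3. Holes are seldom entered (lemma [few_jumps]).  If [x] lies in a hole
    of level [i], the mass of its ball drops by the factor [eps] between the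
    levels [i - k - 2] and [i].  If this happened for a positive proportion of
    levels, a tiny [eps] would force a decay faster than the bound just
    obtained allows.  Hence at almost every [x] around which holes occur
    at all small scales, the factors [1 / 2] are negligible, the weight grows
    like [2 ^ (beta N / 4)], and the second point lowers the dimension by a
    multiple of [beta], that is, of [2 ^- (k s)]. *)

Set Implicit Arguments.
Unset Strict Implicit.
Unset Printing Implicit Defensive.

Local Open Scope classical_set_scope.
Local Open Scope ring_scope.

(** * Cutoff functions and the weights along the scales *)

Section Cutoff.
Context {R : realType} {X : metricType R}.
Implicit Types (V : set X) (r : R) (z y : X).

(** A Lipschitz substitute for the indicator of the [r]-neighbourhood of [V]:
    discontinuous indicators would make the weights below incomparable at
    nearby points. The value [0] makes it vanish far from [V], also when [V] is
    empty. *)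
Definition cutoff V r z : R :=
  sup [set t | t = 0 \/ exists2 y, V y & t = 1 - mdist z y / r].

Lemma cutoff_has_sup V r z : 0 < r ->
  has_sup [set t | t = 0 \/ exists2 y, V y & t = 1 - mdist z y / r].
Proof.
move=> r0; split; first by exists 0; left.
exists 1 => _ [->|[y _ ->]]; first exact: ler01.
by rewrite gerBl divr_ge0 ?mdist_ge0 ?ltW.
Qed.

Lemma cutoff_ge0 V r z : 0 < r -> 0 <= cutoff V r z.
Proof. by move=> r0; apply: ub_le_sup; [case: (cutoff_has_sup V z r0)|left]. Qed.

Lemma cutoff_le1 V r z : 0 < r -> cutoff V r z <= 1.
Proof.
move=> r0; apply: ge_sup; first by case: (cutoff_has_sup V z r0).
move=> _ [->|[y _ ->]]; first exact: ler01.
by rewrite gerBl divr_ge0 ?mdist_ge0 ?ltW.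
Qed.

Lemma cutoff_gt0P V r z : 0 < r -> 0 < cutoff V r z ->
  exists2 y, V y & mdist z y < r.
Proof.
move=> r0 /sup_gt[]; first by case: (cutoff_has_sup V z r0).
move=> _ [->|[y Vy ->]]; first by rewrite ltxx.
by rewrite subr_gt0 ltr_pdivrMr// mul1r => zy; exists y.
Qed.

Lemma cutoff_ge V r z y : 0 < r -> V y -> 1 - mdist z y / r <= cutoff V r z.
Proof.
by move=> r0 Vy; apply: ub_le_sup; [case: (cutoff_has_sup V z r0)|right; exists y].
Qed.

Lemma cutoff_half V r z y : 0 < r -> V y -> mdist z y <= r / 2 ->
  1 / 2 <= cutoff V r z.
Proof.
move=> r0 Vy zy; apply: le_trans (cutoff_ge z r0 Vy).
suff : mdist z y / r <= 1 / 2 by lra.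
by rewrite ler_pdivrMr//; lra.
Qed.

Lemma cutoff_lipschitz V r z z' : 0 < r ->
  cutoff V r z <= cutoff V r z' + mdist z z' / r.
Proof.
move=> r0; apply: ge_sup; first by case: (cutoff_has_sup V z r0).
move=> _ [->|[y Vy ->]].
  by rewrite addr_ge0 ?cutoff_ge0 ?divr_ge0 ?mdist_ge0 ?ltW.
apply: le_trans (lerD (cutoff_ge z' r0 Vy) (lexx _)).
suff : mdist z' y / r <= mdist z y / r + mdist z z' / r by lra.
rewrite -mulrDl ler_pM2r ?invr_gt0// addrC (metric_sym z z').
exact: metric_triangle.
Qed.

End Cutoff.

Section Weight.
Context {R : realType} {X : metricType R}.
Context (r0 : R) (k : nat) (beta : R) (V : nat -> set X).
Context (r0_gt0 : 0 < r0) (beta01 : 0 <= beta <= 1).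

Definition scale (n : nat) : R := r0 / 2 ^+ n.

Lemma scale_gt0 n : 0 < scale n.
Proof. by rewrite divr_gt0// exprn_gt0. Qed.

Lemma scaleS n : scale n.+1 = scale n / 2.
Proof. by rewrite /scale exprSr invfM mulrA. Qed.

Lemma scale_le m n : (n <= m)%N -> scale m <= scale n.
Proof.
move=> nm; rewrite ler_pM2l// lef_pV2 ?posrE ?exprn_gt0//.
by rewrite ler_weXn2l// ler1n.
Qed.

Definition near_hole n z : R := cutoff (V (n + k)) (2 * scale n) z.
Definition in_hole n z : R := cutoff (V n) (scale n) z.
Definition gain n z : R := (1 + beta * near_hole n z) * (1 - in_hole n z / 2).
Definition weight n z : R := \prod_(i < n) gain i z.

Lemma near_hole01 n z : 0 <= near_hole n z <= 1.
Proof. by rewrite cutoff_ge0 ?cutoff_le1// mulr_gt0 ?scale_gt0. Qed.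

Lemma in_hole01 n z : 0 <= in_hole n z <= 1.
Proof. by rewrite cutoff_ge0 ?cutoff_le1// scale_gt0. Qed.

Lemma gain_gt0 n z : 0 < gain n z.
Proof.
have /andP[b0 b1] := beta01; have /andP[u0 u1] := near_hole01 n z.
have /andP[v0 v1] := in_hole01 n z.
by rewrite mulr_gt0//; [have := mulr_ge0 b0 u0; lra|lra].
Qed.

Lemma weight_gt0 n z : 0 < weight n z.
Proof. by apply: prodr_gt0 => i _; exact: gain_gt0. Qed.

Lemma weight_ge0 n z : 0 <= weight n z.
Proof. exact/ltW/weight_gt0. Qed.

Lemma weightS n z : weight n.+1 z = weight n z * gain n z.
Proof. by rewrite /weight big_ord_recr. Qed.

(** Both factors are bounded below by [1 / 2] and Lipschitz with constant of
    order [1 / scale n], hence so are their logarithms. *)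
Lemma gain_comparable n z z' :
  gain n z <= gain n z' * expR (2 * mdist z z' / scale n).
Proof.
have /andP[b0 b1] := beta01; have sn := scale_gt0 n.
have sn2 : 0 < 2 * scale n by rewrite mulr_gt0.
have := cutoff_lipschitz (V (n + k)) z z' sn2.
have := cutoff_lipschitz (V n) z' z sn; rewrite (metric_sym z' z).
have /andP[u0 u1] := near_hole01 n z; have /andP[u0' u1'] := near_hole01 n z'.
have /andP[v0 v1] := in_hole01 n z; have /andP[v0' v1'] := in_hole01 n z'.
rewrite -/(near_hole n z) -/(near_hole n z') -/(in_hole n z) -/(in_hole n z').
have -> : mdist z z' / (2 * scale n) = mdist z z' / scale n / 2.
  by field; rewrite gt_eqF.
have -> : 2 * mdist z z' / scale n = mdist z z' / scale n + mdist z z' / scale n.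
  by field; rewrite gt_eqF.
have : 0 <= mdist z z' / scale n by rewrite divr_ge0 ?mdist_ge0 ?ltW.
rewrite expRD /gain; set t := mdist z z' / scale n => t0 Hv Hu.
have et : 1 + t <= expR t by exact: expR_ge1Dx.
have bu := mulr_ge0 b0 u0; have bu' := mulr_ge0 b0 u0'.
have bt : beta * t <= t by rewrite ler_piMl.
have but := mulr_ge0 bu' t0.
rewrite mulrACA; apply: ler_pM; [lra|lra| |].
- apply: (@le_trans _ _ ((1 + beta * near_hole n z') * (1 + t))).
    by have := ler_wpM2l b0 Hu; lra.
  by rewrite ler_wpM2l//; lra.
- apply: (@le_trans _ _ ((1 - in_hole n z' / 2) * (1 + t))).
    by have : in_hole n z' * t <= t by [rewrite ler_piMl]; lra.
  by rewrite ler_wpM2l//; lra.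
Qed.

(** The Lipschitz constants of the logarithms of the factors form a geometric
    progression, so that only the last level matters: the weight is nearly
    constant on balls of radius [scale n]. *)
Lemma weight_comparable n z z' :
  weight n z <= weight n z' * expR (2 * mdist z z' / scale n).
Proof.
elim: n => [|n IH].
  rewrite /weight !big_ord0 mul1r -expR0 ler_expR.
  by rewrite divr_ge0 ?mulr_ge0 ?mdist_ge0// ltW ?scale_gt0.
rewrite !weightS scaleS.
have -> : 2 * mdist z z' / (scale n / 2) =
    2 * mdist z z' / scale n + 2 * mdist z z' / scale n.
  by field; rewrite gt_eqF ?scale_gt0.
rewrite expRD mulrACA; apply: ler_pM.
- exact/ltW/weight_gt0.
- exact/ltW/gain_gt0.
- exact: IH.
- exact: gain_comparable.
Qed.

Lemma weight_grow m n z : (n <= m)%N ->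
  (forall j, (n <= j < m)%N -> in_hole j z = 0) -> weight n z <= weight m z.
Proof.
elim: m => [|m IH]; first by rewrite leqn0 => /eqP->.
rewrite leq_eqVlt => /predU1P[->//|]; rewrite ltnS => nm H.
apply: le_trans (IH nm _) _.
  by move=> j /andP[nj jm]; apply: H; rewrite nj/= ltnS ltnW.
rewrite weightS ler_peMr ?weight_ge0// /gain H ?nm ?ltnSn//.
have /andP[b0 b1] := beta01; have /andP[u0 u1] := near_hole01 m z.
by rewrite mul0r subr0 mulr1 lerDl mulr_ge0.
Qed.

(** The level [m] is the least one admitting a hole centre within
    [2 * scale n + 2 * scale m] of [z]. The allowed distance shrinks with the
    level just fast enough that a centre [y] lying in a hole of a level between
    [n] and [m] would contradict minimality. *)
Lemma outermost_hole n z : 0 < near_hole n z ->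
  exists m y, [/\ (n <= m <= n + k)%N, V m y, mdist z y <= 4 * scale n &
    forall j, (n <= j < m)%N -> in_hole j y = 0].
Proof.
have s2 : 0 < 2 * scale n by rewrite mulr_gt0 ?scale_gt0.
move=> /(cutoff_gt0P s2)[y0 Vy0 zy0].
pose P m := (n <= m)%N &&
  `[< exists2 y, V m y & mdist z y <= 2 * scale n + 2 * scale m >].
have exP : exists m, P m.
  exists (n + k)%N; rewrite /P leq_addr/=; apply/asboolP; exists y0 => //.
  by have := scale_gt0 (n + k); lra.
case: (ex_minnP exP) => m /andP[nm /asboolP[y Vy zy]] mmin.
have mnk : (m <= n + k)%N.
  apply: mmin; rewrite /P leq_addr/=; apply/asboolP; exists y0 => //.
  by have := scale_gt0 (n + k); lra.
exists m, y; split => //; first by rewrite nm mnk.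
  by have := scale_le nm; lra.
move=> j /andP[nj jm]; apply/eqP/contraT => vj.
have : 0 < in_hole j y by rewrite lt_neqAle eq_sym vj; case/andP: (in_hole01 j y).
move=> /(cutoff_gt0P (scale_gt0 j)) [y' Vy' yy'].
suff : (m <= j)%N by rewrite leqNgt jm.
apply: mmin; rewrite /P nj/=; apply/asboolP; exists y' => //.
have := metric_triangle z y y'; have := scale_le jm; rewrite scaleS.
by lra.
Qed.

(** The weight of [z], where it is about to increase, is at most a constant times
    the weight of each net point in the core of the outermost hole near [z];
    averaging over those points, whose number is about [q ^+ (N - m)], charges
    [z] to this hole. The sum over [i] ranges over the possible levels
    [m = n + i] of the hole. *)
Lemma charge (Z : seq X) (N : nat) (D q : R) n z : 0 < D -> 1 <= q ->
  (forall m y, V m y ->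
    q ^+ (N - m) <= D * \sum_(z' <- Z | mdist z' y <= scale m / 2) 1) ->
  weight n z * near_hole n z <= \sum_(i < k.+1)
    2 * D * expR 9 / q ^+ (N - (n + i)) *
    \sum_(z' <- Z | mdist z z' <= 5 * scale n) weight (n + i) z' * in_hole (n + i) z'.
Proof.
move=> D0 q1 low; have q0 : 0 < q by exact: lt_le_trans q1.
have /andP[u0 u1] := near_hole01 n z.
have wv0 i z' : 0 <= weight i z' * in_hole i z'.
  by rewrite mulr_ge0 ?weight_ge0//; case/andP: (in_hole01 i z').
have term0 (i : 'I_k.+1) : 0 <= 2 * D * expR 9 / q ^+ (N - (n + i)) *
    \sum_(z' <- Z | mdist z z' <= 5 * scale n) weight (n + i) z' * in_hole (n + i) z'.
  rewrite mulr_ge0 ?divr_ge0 ?mulr_ge0 ?expR_ge0 ?exprn_ge0 ?(ltW D0) ?(ltW q0)//.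
  by apply: sumr_ge0 => z' _; exact: wv0.
have [unz|] := ltP 0 (near_hole n z); last first.
  move=> u0'; have -> : near_hole n z = 0 by apply/eqP; rewrite eq_le u0 u0'.
  by rewrite mulr0; apply: sumr_ge0.
have [m [y [/andP[nm mnk] Vy zy ynohole]]] := outermost_hole unz.
have im : (m - n < k.+1)%N by rewrite ltnS leq_subLR.
rewrite (bigD1 (Ordinal im))//= subnKC//.
apply: ler_wpDr; first by apply: sumr_ge0.
apply: (@le_trans _ _ (weight n z)).
  by rewrite ler_piMr// weight_ge0.
rewrite mulrAC ler_pdivlMr ?exprn_gt0//.
apply: le_trans
  (_ : weight n z * (D * \sum_(z' <- Z | mdist z' y <= scale m / 2) 1) <= _).
  by rewrite ler_wpM2l ?low// weight_ge0.
set S1 := \sum_(z' <- Z | _) 1; set S2 := \sum_(z' <- Z | _) _.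
have -> : weight n z * (D * S1) = D * (weight n z * S1) by ring.
have -> : 2 * D * expR 9 * S2 = D * (2 * expR 9 * S2) by ring.
rewrite ler_wpM2l ?(ltW D0)// !mulr_sumr.
have sm := scale_gt0 m; have sn := scale_gt0 n; have smn := scale_le nm.
rewrite big_mkcond [leRHS]big_mkcond/=; apply: ler_sum => z' _.
case: ifPn => z'y; last first.
  by case: ifPn => // _; rewrite mulr_ge0// mulr_ge0 ?expR_ge0.
have dzz' := metric_triangle z y z'; rewrite (metric_sym y) in dzz'.
have -> : mdist z z' <= 5 * scale n by lra.
have vz' : 1 / 2 <= in_hole m z' by exact: (cutoff_half _ Vy).
rewrite mulr1.
have H1 : weight n z <= weight n y * expR 8.
  apply: le_trans (weight_comparable n z y) _.
  rewrite ler_wpM2l ?ler_expR ?weight_ge0//.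
  by rewrite ler_pdivrMr//; lra.
have H2 : weight m y <= weight m z' * expR 1.
  apply: le_trans (weight_comparable m y z') _.
  rewrite ler_wpM2l ?ler_expR ?weight_ge0//.
  by rewrite ler_pdivrMr// metric_sym; lra.
have H3 := weight_grow nm ynohole.
have -> : expR 9 = expR 1 * expR 8 :> R by rewrite -expRD; congr expR; lra.
have e8 : 0 < expR 8 :> R := expR_gt0 _.
have e1 : 0 < expR 1 :> R := expR_gt0 _.
have wz' := weight_gt0 m z'.
apply: le_trans H1 _.
apply: (@le_trans _ _ (weight m z' * expR 1 * expR 8)).
  by rewrite ler_wpM2r ?(ltW e8)//; exact: le_trans H2.
rewrite [leRHS](_ : _ = expR 1 * expR 8 * weight m z' * (2 * in_hole m z')); last by ring.
rewrite [leLHS](_ : _ = expR 1 * expR 8 * weight m z'); last by ring.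
by rewrite ler_peMr ?mulr_ge0 ?(ltW e8) ?(ltW e1) ?(ltW wz')//; lra.
Qed.

(** The increments of the total weight telescope. Summing the charges over [z],
    a net point in a hole of level [n + i] is charged from level [n] at most
    [D ^ 2 * q ^+ i] times up to a constant, so for small [beta] the total gain
    is below the total loss, which is half of the weight carried by holes. *)
Lemma weight_sum_le (Z : seq X) (N : nat) (D q : R) : 0 < D -> 1 <= q ->
  (forall m y, V m y -> (m <= N)%N) ->
  (forall n z', (n <= N)%N ->
    \sum_(z <- Z | mdist z z' <= 5 * scale n) 1 <= D * q ^+ (N - n)) ->
  (forall m y, V m y ->
    q ^+ (N - m) <= D * \sum_(z <- Z | mdist z y <= scale m / 2) 1) ->
  beta * (4 * D ^+ 2 * expR 9 * \sum_(i < k.+1) q ^+ i) <= 1 ->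
  \sum_(z <- Z) weight N.+1 z <= \sum_(z <- Z) 1.
Proof.
move=> D0 q1 VN up low Hbeta; have q0 : 0 < q by exact: lt_le_trans q1.
have /andP[b0 b1] := beta01.
have wv0 i z' : 0 <= weight i z' * in_hole i z'.
  by rewrite mulr_ge0 ?weight_ge0//; case/andP: (in_hole01 i z').
pose T m := \sum_(z <- Z) weight m z * in_hole m z.
have T0 m : 0 <= T m by apply: sumr_ge0.
have TN m : (N < m)%N -> T m = 0.
  move=> Nm; rewrite /T big1// => z _; apply/eqP; rewrite mulf_eq0; apply/orP; right.
  apply/negPn/negP => vj.
  have : 0 < in_hole m z by rewrite lt_neqAle eq_sym vj; case/andP: (in_hole01 m z).
  by move=> /(cutoff_gt0P (scale_gt0 m)) [y /VN]; rewrite leqNgt Nm.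
pose E : R := expR 9; have E0 : 0 < E := expR_gt0 _.
have charge_sum n : (n <= N)%N -> \sum_(z <- Z) weight n z * near_hole n z <=
    \sum_(i < k.+1) 2 * D ^+ 2 * E * q ^+ i * T (n + i)%N.
  move=> nN.
  apply: le_trans (ler_sum _ (fun z _ => charge n z D0 q1 low)) _.
  rewrite exchange_big/=; apply: ler_sum => i _.
  rewrite -mulr_sumr -/E.
  have [niN|Nni] := leqP (n + i) N; last first.
    rewrite TN// mulr0 [X in _ * X]big1 ?mulr0// => z _.
    rewrite big_mkcond/=; apply: big1 => z' _; case: ifP => // _.
    have := TN _ Nni; rewrite /T => T00.
    have [vj|/negPn/eqP->] := boolP (in_hole (n + i) z' != 0); last by rewrite mulr0.
    have : 0 < in_hole (n + i) z'.
      by rewrite lt_neqAle eq_sym vj; case/andP: (in_hole01 (n + i) z').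
    by move=> /(cutoff_gt0P (scale_gt0 (n + i))) [y /VN]; rewrite leqNgt Nni.
  rewrite (exchange_big_dep xpredT)//=.
  rewrite [leLHS](_ : _ = 2 * D * E / q ^+ (N - (n + i)) * \sum_(z' <- Z)
      weight (n + i) z' * in_hole (n + i) z' * \sum_(z <- Z | mdist z z' <= 5 * scale n) 1).
    apply: (@le_trans _ _ (2 * D * E / q ^+ (N - (n + i)) * (T (n + i)%N * (D * q ^+ (N - n))))).
      rewrite ler_wpM2l ?divr_ge0 ?mulr_ge0 ?exprn_ge0 ?(ltW D0) ?(ltW E0) ?(ltW q0)//.
      rewrite mulr_suml; apply: ler_sum => z' _; rewrite ler_wpM2l//.
      exact: up.
    have -> : (N - n = N - (n + i) + i)%N by lia.
    rewrite exprD le_eqVlt; apply/orP; left; apply/eqP; field.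
    by rewrite expf_eq0 gt_eqF ?andbF.
  congr (_ * _); apply: eq_bigr => z' _; rewrite mulr_sumr.
  by apply: eq_bigr => z _; rewrite mulr1.
have step n : (n <= N)%N -> \sum_(z <- Z) weight n.+1 z - \sum_(z <- Z) weight n z <=
    beta * \sum_(i < k.+1) 2 * D ^+ 2 * E * q ^+ i * T (n + i)%N - T n / 2.
  move=> nN.
  apply: le_trans (lerB (ler_wpM2l b0 (charge_sum n nN)) (lexx _)).
  rewrite /T mulr_suml mulr_sumr -!sumrB; apply: ler_sum => z _.
  rewrite weightS /gain.
  have := weight_gt0 n z; have := near_hole01 n z; have := in_hole01 n z.
  set w := weight n z; set u := near_hole n z; set v := in_hole n z.
  move=> /andP[v0 v1] /andP[u0 u1] w0.
  have -> : w * ((1 + beta * u) * (1 - v / 2)) - w =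
    beta * (w * u) - w * v / 2 - beta * u * w * v / 2 by field.
  rewrite gerBl; rewrite divr_ge0// !mulr_ge0//; exact: ltW.
have -> : \sum_(z <- Z) 1 = \sum_(z <- Z) weight 0 z.
  by apply: eq_bigr => z _; rewrite /weight big_ord0.
rewrite -subr_le0 -(telescope_sumr (fun n => \sum_(z <- Z) weight n z) (leq0n N.+1)).
apply: le_trans (_ : \sum_(0 <= n < N.+1)
  (beta * \sum_(i < k.+1) 2 * D ^+ 2 * E * q ^+ i * T (n + i)%N - T n / 2) <= _).
  by rewrite !big_nat; apply: ler_sum => n /andP[_ nN]; exact: step.
rewrite sumrB -mulr_sumr -mulr_suml exchange_big/=.
have shift i : \sum_(0 <= n < N.+1) T (n + i)%N <= \sum_(0 <= n < N.+1) T n.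
  elim: i => [|i IH]; first by under eq_bigr do rewrite addn0.
  apply: le_trans IH; rewrite [leRHS]big_nat_recl// big_nat_recr//= TN ?addr0; last lia.
  rewrite [leLHS](eq_bigr (fun n => T (n.+1 + i)%N)); first by rewrite lerDr.
  by move=> n _; rewrite addSnnS.
set S := \sum_(0 <= n < N.+1) T n in shift *.
have : \sum_(i < k.+1) \sum_(0 <= n < N.+1) 2 * D ^+ 2 * E * q ^+ i * T (n + i)%N
    <= 2 * D ^+ 2 * E * (\sum_(i < k.+1) q ^+ i) * S.
  rewrite [leRHS](_ : _ = \sum_(i < k.+1) 2 * D ^+ 2 * E * q ^+ i * S); last first.
    by rewrite -mulr_suml -mulr_sumr.
  apply: ler_sum => i _; rewrite -mulr_sumr.
  by rewrite ler_wpM2l// !mulr_ge0 ?exprn_ge0 ?ltW.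
move=> /(ler_wpM2l b0).
have S0 : 0 <= S by apply: sumr_ge0.
rewrite subr_le0 => /le_trans; apply.
rewrite mulrA [leLHS](_ : _ = beta * (4 * D ^+ 2 * expR 9 * (\sum_(i < k.+1) q ^+ i)) * (S / 2)).
  by rewrite ler_piMl ?divr_ge0.
by rewrite /E; field.
Qed.

End Weight.

(** * Counting points of separated nets *)

Section Balls.
Context {R : realType} {X : metricType R}.
Implicit Types (mu nu : {outer_measure set X -> \bar R}).

Lemma cball_closed (x : X) (r : R) : closed (cball x r).
Proof.
rewrite -[cball x r]setCK; apply: open_closedC; rewrite openE => y /= /negP.
rewrite -ltNge => xy; apply/nbhs_ballP; exists (mdist x y - r) => /=.
  by rewrite subr_gt0.
move=> z; rewrite ballEmdist/= => yz; apply/negP; rewrite -ltNge.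
have := metric_triangle x z y; rewrite (metric_sym z y); lra.
Qed.

Lemma cball_borel (x : X) (r : R) : borel_set (cball x r).
Proof.
rewrite /borel_set -[cball x r]setCK -setTD; apply: sigma_algebraCD.
by apply: sub_sigma_algebra; exact/closed_openC/cball_closed.
Qed.

Lemma cball_subset (x y : X) (r t : R) : mdist x y + r <= t ->
  cball y r `<=` cball x t.
Proof.
move=> H z; rewrite /cball/= => yz; have := metric_triangle x y z; lra.
Qed.

Lemma cball_fin mu (x : X) (r : R) : is_metric_measure mu ->
  mu (cball x r) \is a fin_num.
Proof.
move=> mmu; rewrite ge0_fin_numE ?outer_measure_ge0//.
by apply: (mm_bounded mmu); exists x, r.
Qed.

(** Balls around separated points are disjoint Borel sets, and the outer measure
    is additive on them by the condition of Caratheodory. *)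
Lemma sum_separated_le mu (Z : seq X) (P : pred X) (r c : R) (A : set X) :
  is_metric_measure mu -> pairwise [rel x y | 2 * r < mdist x y] Z ->
  (forall z, z \in Z -> P z -> cball z r `<=` A) ->
  (forall z, c%:E <= mu (cball z r))%E ->
  ((\sum_(z <- Z | P z) c)%:E <= mu A)%E.
Proof.
move=> mmu; elim: Z A => [|z Z IH] A; first by rewrite big_nil outer_measure_ge0.
rewrite pairwise_cons big_cons => /andP[/allP zZ sZ] sub low.
have subZ z' : z' \in Z -> P z' -> cball z' r `<=` A.
  by move=> z'Z; apply: sub; rewrite in_cons z'Z orbT.
case: ifPn => Pz; last exact: IH.
rewrite (mm_borel mmu (cball_borel z r) A) EFinD; apply: leeD.
  apply: le_trans (low z) _; apply: le_outer_measure => y zy; split => //.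
  by apply: sub zy; rewrite ?mem_head.
apply: IH => // z' z'Z Pz' y z'y; split; first exact: subZ z'y.
move=> zy; have := zZ _ z'Z; rewrite /= ltNge => /negP; apply.
have := metric_triangle z y z'; rewrite (metric_sym y z').
move: zy z'y; rewrite /cball/=; lra.
Qed.

Lemma outer_measure_cover_seq mu (Z : seq X) (P : pred X) (F : X -> set X)
    (A : set X) :
  (forall x, A x -> exists z, [/\ z \in Z, P z & F z x]) ->
  (mu A <= \sum_(z <- Z | P z) mu (F z))%E.
Proof.
elim: Z A => [|z Z IH] A cov.
  rewrite big_nil (_ : A = set0) ?outer_measure0//.
  by apply/seteqP; split => // x /cov[? []].
rewrite big_cons; case: ifPn => Pz.
  apply: (@le_trans _ _ (mu (F z) + mu (A `\` F z))%E).
    apply: le_trans (outer_measureU2 mu _ _); apply: le_outer_measure => x Ax.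
    by have [Fx|Fx] := pselect (F z x); [left|right].
  apply: leeD => //; apply: IH => x [/cov[z' []]]; rewrite in_cons.
  by move=> /predU1P[->//|z'Z Pz' Fz'] _; exists z'.
apply: IH => x /cov[z' []]; rewrite in_cons => /predU1P[->|z'Z Pz' Fz'].
  by move=> Pz'; rewrite Pz' in Pz.
by exists z'.
Qed.

Definition is_net (o : X) (r sigma : R) (Z : seq X) :=
  [/\ forall z, z \in Z -> cball o r z,
      pairwise [rel x y | sigma < mdist x y] Z &
      forall x, cball o r x -> exists2 z, z \in Z & mdist x z <= sigma].

(** A separated set of maximal size is a net. *)
Lemma net_exists (o : X) (r sigma : R) (K : nat) :
  (forall Z : seq X, (forall z, z \in Z -> cball o r z) ->
     pairwise [rel x y | sigma < mdist x y] Z -> (size Z <= K)%N) ->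
  exists Z, is_net o r sigma Z.
Proof.
move=> bound.
pose P n := `[< exists Z : seq X, [/\ size Z = n, forall z, z \in Z -> cball o r z &
     pairwise [rel x y | sigma < mdist x y] Z] >].
have exP : exists n, P n by exists 0%N; apply/asboolP; exists [::].
have leP n : P n -> (n <= K)%N by move=> /asboolP[Z [<- ? ?]]; exact: bound.
case: (ex_maxnP exP leP) => n /asboolP[Z [Zn Zb Zs]] nmax.
exists Z; split => // x ox; apply/not_exists2P => H.
suff : (n.+1 <= n)%N by rewrite ltnn.
apply: nmax; apply/asboolP; exists (x :: Z); split.
- by rewrite /= Zn.
- by move=> z; rewrite in_cons => /predU1P[->//|/Zb].
- rewrite pairwise_cons Zs andbT; apply/allP => z zZ /=.
  by have [//|/negP] := H z; rewrite -ltNge.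
Qed.

End Balls.

Lemma powR_exprn (R : realType) (x s : R) n : 0 <= x ->
  (x ^+ n) `^ s = (x `^ s) ^+ n.
Proof.
move=> x0; rewrite -(powR_mulrn n x0) -(powR_mulrn n (powR_ge0 x s)).
exact: powRAC.
Qed.

Section RegularNets.
Context {R : realType} {X : metricType R} (s a b r0 : R).
Context (nu : {outer_measure set X -> \bar R}).
Context (s_gt0 : 0 < s) (a_gt0 : 0 < a) (b_gt0 : 0 < b) (r0_gt0 : 0 < r0).
Context (reg : regular_with s a b nu) (r0diam : ((6 * r0)%:E <= mdiam X)%E).

Let q := (2 : R) `^ s.
Let D := b / a * 48 `^ s.

Lemma regular_ball (x : X) r : 0 < r -> r <= 6 * r0 ->
  ((a * r `^ s)%:E <= nu (cball x r) <= (b * r `^ s)%:E)%E.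
Proof.
move=> r_gt0 rr0; apply: reg.2 => //; apply: le_trans r0diam; by rewrite lee_fin.
Qed.

Lemma exprn_powR (n : nat) : ((2 : R) ^+ n) `^ s = q ^+ n.
Proof. exact: powR_exprn. Qed.

Lemma powR_dilate (c t : R) (n : nat) : 0 <= c -> 0 <= t ->
  (c * 2 ^+ n * t) `^ s = c `^ s * q ^+ n * t `^ s.
Proof. by move=> c0 t0; rewrite !powRM ?mulr_ge0 ?exprn_ge0// exprn_powR. Qed.

Lemma scale_subn n N : (n <= N)%N -> scale r0 n = 2 ^+ (N - n) * scale r0 N.
Proof.
move=> nN; rewrite /scale -{2}(subnK nN) exprD.
by field; rewrite !expf_eq0 !gt_eqF// !andbF.
Qed.

Lemma scale_le0 n : scale r0 n <= r0.
Proof. by apply: le_trans (scale_le r0_gt0 (leq0n n)) _; rewrite /scale divr1. Qed.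

Lemma regular_net_le (Z : seq X) (P : pred X) N (A : set X) :
  pairwise [rel x y | scale r0 N / 4 < mdist x y] Z ->
  (forall z, z \in Z -> P z -> cball z (scale r0 N / 8) `<=` A) ->
  ((a * (scale r0 N / 8) `^ s * \sum_(z <- Z | P z) 1)%:E <= nu A)%E.
Proof.
move=> sZ sub; have sN := scale_gt0 r0_gt0 N; have sN0 := scale_le0 N.
rewrite mulr_sumr (eq_bigr (fun=> a * (scale r0 N / 8) `^ s)); last first.
  by move=> *; rewrite mulr1.
apply: sum_separated_le sub _; first by case: reg.
- rewrite (_ : 2 * (scale r0 N / 8) = scale r0 N / 4)//; lra.
- by move=> z; case/andP: (regular_ball z (r := scale r0 N / 8) ltac:(lra) ltac:(lra)).
Qed.

Lemma regular_net_exists (o : X) (r : R) N :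
  exists Z, is_net o r (scale r0 N / 4) Z.
Proof.
have [M HM] : exists M, nu (cball o (r + r0)) = M%:E.
  have /fineK <- := cball_fin o (r + r0) reg.1.
  by exists (fine (nu (cball o (r + r0)))).
have sN := scale_gt0 r0_gt0 N; have sN0 := scale_le0 N.
have p0 : 0 < a * (scale r0 N / 8) `^ s.
  by rewrite mulr_gt0// powR_gt0//; lra.
apply: (@net_exists _ _ _ _ _ (Num.truncn (M / (a * (scale r0 N / 8) `^ s))).+1).
move=> Z Zb Zs.
have /= := regular_net_le (P := predT) (A := cball o (r + r0)) Zs.
rewrite HM lee_fin big_const_seq count_predT iter_addr_0 -ler_pdivlMl// => H.
rewrite -(ler_nat R) ltW//; apply: le_lt_trans (H _) _.
  by move=> z /Zb oz _; apply: cball_subset; move: oz; rewrite /cball/=; lra.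
by rewrite [_^-1 * _]mulrC truncnS_gt.
Qed.

(** Compare the balls of radius [scale r0 N / 8] about the net points with the ball
    of radius [6 * scale r0 n] about [z']; the ratio of these radii is
    [48 * 2 ^+ (N - n)], whence the constant in [D]. *)
Lemma net_count_le (Z : seq X) (z' : X) n N : (n <= N)%N ->
  pairwise [rel x y | scale r0 N / 4 < mdist x y] Z ->
  \sum_(z <- Z | mdist z z' <= 5 * scale r0 n) 1 <= D * q ^+ (N - n).
Proof.
move=> nN sZ; have sN := scale_gt0 r0_gt0 N; have sn := scale_gt0 r0_gt0 n.
have sn0 := scale_le0 n; have snN := scale_le r0_gt0 nN.
have := regular_net_le (P := fun z => mdist z z' <= 5 * scale r0 n)
  (A := cball z' (6 * scale r0 n)) sZ.
have /andP[_ H] := regular_ball z' (r := 6 * scale r0 n) ltac:(lra) ltac:(lra).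
move=> /(_ _) /le_trans => /(_ _ _ H); rewrite lee_fin.
have -> : (6 * scale r0 n) `^ s = 48 `^ s * q ^+ (N - n) * (scale r0 N / 8) `^ s.
  rewrite -powR_dilate//; last lra.
  by congr (_ `^ _); rewrite (scale_subn nN); field.
move=> H1.
have p0 : 0 < a * (scale r0 N / 8) `^ s.
  by rewrite mulr_gt0// powR_gt0//; lra.
rewrite -(ler_pM2l p0); apply: le_trans (H1 _) _.
  move=> z _ zz'; apply: cball_subset; rewrite metric_sym; lra.
rewrite /D le_eqVlt; apply/orP; left; apply/eqP; field.
by rewrite gt_eqF.
Qed.

(** The net balls that meet the ball of radius [scale r0 m / 4] about [y] cover
    it, and their centres are within [scale r0 m / 2] of [y]. *)
Lemma net_count_ge (Z : seq X) (o y : X) (r : R) m N : (m <= N)%N ->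
  is_net o r (scale r0 N / 4) Z -> cball y (scale r0 m / 4) `<=` cball o r ->
  q ^+ (N - m) <= D * \sum_(z <- Z | mdist z y <= scale r0 m / 2) 1.
Proof.
move=> mN [_ _ Zcov] ysub; have sN := scale_gt0 r0_gt0 N; have sm := scale_gt0 r0_gt0 m.
have sm0 := scale_le0 m; have smN := scale_le r0_gt0 mN.
have /andP[H _] := regular_ball y (r := scale r0 m / 4) ltac:(lra) ltac:(lra).
have : (nu (cball y (scale r0 m / 4)) <=
    \sum_(z <- Z | (mdist z y <= scale r0 m / 2)%R) nu (cball z (scale r0 N / 4)))%E.
  apply: outer_measure_cover_seq => x yx; have [z zZ xz] := Zcov _ (ysub _ yx).
  exists z; split => //; last by rewrite /cball/= metric_sym.
  have := metric_triangle z x y; rewrite (metric_sym z x) (metric_sym x y).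
  move: yx; rewrite /cball/=; lra.
move=> /(le_trans H) H1.
have : ((a * (scale r0 m / 4) `^ s)%:E <=
    \sum_(z <- Z | (mdist z y <= scale r0 m / 2)%R) (b * (scale r0 N / 4) `^ s)%:E)%E.
  apply: le_trans H1 _; apply: lee_sum => z _.
  by case/andP: (regular_ball z (r := scale r0 N / 4) ltac:(lra) ltac:(lra)).
rewrite sumEFin lee_fin.
have p0 : 0 < (scale r0 N / 4) `^ s by rewrite powR_gt0//; lra.
rewrite (eq_bigr (fun=> b * (scale r0 N / 4) `^ s * 1)); last by move=> *; rewrite mulr1.
rewrite -mulr_sumr.
have -> : (scale r0 m / 4) `^ s = q ^+ (N - m) * (scale r0 N / 4) `^ s.
  rewrite (_ : scale r0 m / 4 = 1 * 2 ^+ (N - m) * (scale r0 N / 4)); last first.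
    by rewrite (scale_subn mN); field.
  by rewrite powR_dilate//; [rewrite powR1 mul1r|lra].
set S := \sum_(z <- Z | _) 1 => H2.
have S0 : 0 <= S by apply: sumr_ge0.
apply: (@le_trans _ _ (b / a * S)).
  rewrite -(ler_pM2r (mulr_gt0 a_gt0 p0)).
  rewrite [leRHS](_ : _ = b * (scale r0 N / 4) `^ s * S); last by field; rewrite gt_eqF.
  by rewrite mulrCA; rewrite mulrA in H2 *.
rewrite /D ler_wpM2r// ler_peMr ?divr_ge0 ?(ltW a_gt0) ?(ltW b_gt0)//.
have l48 : 1 <= 48 :> R by lra.
by have := ler_powR l48 (ltW s_gt0); rewrite powRr0.
Qed.

Lemma net_size_le (o : X) (r : R) : exists2 C, 0 < C & forall N Z,
  is_net o r (scale r0 N / 4) Z -> \sum_(z <- Z) 1 <= C * q ^+ N.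
Proof.
have [M HM] : exists M, nu (cball o (r + r0)) = M%:E.
  have /fineK <- := cball_fin o (r + r0) reg.1.
  by exists (fine (nu (cball o (r + r0)))).
have M0 : 0 <= M by rewrite -lee_fin -HM outer_measure_ge0.
have p0 : 0 < a * (r0 / 8) `^ s by rewrite mulr_gt0// powR_gt0// divr_gt0.
exists ((M + 1) / (a * (r0 / 8) `^ s)); first by rewrite divr_gt0//; lra.
move=> N Z [Zb Zs _]; have sN := scale_gt0 r0_gt0 N; have sN0 := scale_le0 N.
have /= := regular_net_le (P := predT) (A := cball o (r + r0)) Zs.
rewrite HM lee_fin => /(_ _) H.
have {H} := H _; move=> H.
have {}H : a * (scale r0 N / 8) `^ s * \sum_(z <- Z) 1 <= M.
  by apply: H => z /Zb oz _; apply: cball_subset; move: oz; rewrite /cball/=; lra.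
have q0 : 0 < q ^+ N by rewrite exprn_gt0// powR_gt0.
have E : (r0 / 8) `^ s = q ^+ N * (scale r0 N / 8) `^ s.
  rewrite (_ : r0 / 8 = 1 * 2 ^+ N * (scale r0 N / 8)); last first.
    have := scale_subn (leq0n N); rewrite subn0 {1}/scale divr1 => {1}->.
    by field.
  by rewrite powR_dilate//; [rewrite powR1 mul1r|lra].
have p1 : 0 < (scale r0 N / 8) `^ s by rewrite powR_gt0//; lra.
rewrite E [leRHS](_ : _ = (M + 1) / (a * (scale r0 N / 8) `^ s)); last first.
  by field; rewrite !gt_eqF.
by rewrite ler_pdivlMr ?mulr_gt0// mulrC; lra.
Qed.

End RegularNets.

(** * Powers of two, null sets and lower mass bounds *)

Section Powers.
Context {R : realType}.

Lemma pow2D (x y : R) : 2 `^ (x + y) = 2 `^ x * 2 `^ y :> R.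
Proof. by rewrite powRD// pnatr_eq0 implybT. Qed.

Lemma pow2X (x : R) n : (2 `^ x) ^+ n = 2 `^ (x * n%:R) :> R.
Proof. by rewrite -powR_mulrn ?powR_ge0// -powRrM. Qed.

Lemma pow2_gt0 (x : R) : 0 < 2 `^ x :> R.
Proof. by rewrite powR_gt0. Qed.

Lemma pow2_le (x y : R) : x <= y -> 2 `^ x <= 2 `^ y :> R.
Proof. by move=> xy; apply: ler_powR => //; rewrite ler1n. Qed.

Lemma pow2N1 : 2 `^ (-1) = 2^-1 :> R.
Proof. by rewrite powR_inv1. Qed.

Lemma pow2_lt1 (x : R) : x < 0 -> 2 `^ x < 1 :> R.
Proof.
move=> x0; rewrite /powR pnatr_eq0/= expR_lt1 pmulr_llt0// ln_gt0//.
by rewrite ltr1n.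
Qed.

Lemma pow2_le1 (x : R) : x <= 0 -> 2 `^ x <= 1 :> R.
Proof. by move=> /pow2_le; rewrite powRr0. Qed.

Lemma pow2_ge1 (x : R) : 0 <= x -> 1 <= 2 `^ x :> R.
Proof. by move=> /pow2_le; rewrite powRr0. Qed.

Lemma exprn_lt_eventually (t e : R) : 0 <= t < 1 -> 0 < e ->
  exists n0, forall n, (n0 <= n)%N -> t ^+ n < e.
Proof.
move=> /andP[t0 t1] e0.
have : t ^+ n @[n --> \oo] --> (0 : R) by apply: cvg_expr; rewrite ger0_norm.
move=> /cvgr0_norm_lt /(_ e e0)[n0 _ H]; exists n0 => n nn0.
by have := H n nn0; rewrite /= ger0_norm// exprn_ge0.
Qed.

(** From [expR (- x) >= 1 - x] and [ln 2 <= 1]. *)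
Lemma pow2_le1D (x : R) : 0 <= x <= 1 / 2 -> 2 `^ x <= 1 + 2 * x :> R.
Proof.
move=> /andP[x0 x1]; rewrite /powR pnatr_eq0/=.
have ln2 : ln 2 <= 1 :> R by have := @le_ln1Dx R 1; rewrite -[1 + 1]/2; apply; lra.
have : x * ln 2 <= x by rewrite ler_piMr.
move=> H; apply: (@le_trans _ _ (expR x)); first by rewrite ler_expR.
have := expR_ge1Dx (- x); rewrite expRN => H1.
have ex := expR_gt0 x.
have : (1 - x) * expR x <= 1.
  by rewrite -ler_pdivlMr// div1r.
have : 1 <= (1 - x) * (1 + 2 * x) by nra.
move=> H2 H3; rewrite -(@ler_pM2l _ (1 - x)); first exact: le_trans H2.
lra.
Qed.

End Powers.

Section NullSets.
Context {R : realType} {T : Type}.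
Implicit Types (mu : {outer_measure set T -> \bar R}).

Lemma outer_null_subset mu (A B : set T) : A `<=` B -> mu B = 0%E -> mu A = 0%E.
Proof.
move=> AB B0; apply/eqP; rewrite eq_le outer_measure_ge0 andbT -B0.
exact: le_outer_measure.
Qed.

Lemma outer_null_setU mu (A B : set T) : mu A = 0%E -> mu B = 0%E -> mu (A `|` B) = 0%E.
Proof.
move=> A0 B0; apply/eqP; rewrite eq_le outer_measure_ge0 andbT.
by apply: le_trans (outer_measureU2 mu A B) _; rewrite A0 B0 adde0.
Qed.

Lemma outer_null_bigcup mu (F : nat -> set T) : (forall n, mu (F n) = 0%E) ->
  mu (\bigcup_n F n) = 0%E.
Proof.
move=> F0; apply/eqP; rewrite eq_le outer_measure_ge0 andbT.
apply: le_trans (outer_measure_sigma_subadditive mu F) _.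
by rewrite eseries0.
Qed.

(** By countable subadditivity the limit superior is at most every tail of a
    convergent geometric series. *)
Lemma outer_borel_cantelli mu (E : nat -> set T) (C t : R) : 0 < C -> 0 < t < 1 ->
  (forall n, (mu (E n) <= (C * t ^+ n)%:E)%E) ->
  mu [set x | ~ exists n0, forall n, (n0 <= n)%N -> ~ E n x] = 0%E.
Proof.
move=> C0 /andP[t0 t1] muE; set S := [set x | _].
have t1' : 0 < 1 - t by lra.
have bound n : (mu S <= (C / (1 - t) * t ^+ n)%:E)%E.
  apply: (@le_trans _ _ (mu (\bigcup_i E (n + i)%N))).
    apply: le_outer_measure => x Sx; apply: contrapT => nE; apply: Sx.
    exists n => m nm Em; apply: nE; exists (m - n)%N => //.
    by rewrite subnKC.
  apply: le_trans (outer_measure_sigma_subadditive mu _) _.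
  apply: lime_le; first by apply: is_cvg_nneseries => i _ _; exact: outer_measure_ge0.
  apply: nearW => m.
  apply: le_trans (_ : \sum_(0 <= i < m) (C * t ^+ (n + i))%:E <= _)%E.
    by apply: lee_sum => i _; exact: muE.
  rewrite sumEFin lee_fin.
  under eq_bigr do rewrite exprD mulrA.
  rewrite -mulr_sumr big_mkord.
  rewrite (_ : C / (1 - t) * t ^+ n = C * t ^+ n * (1 - t)^-1); last by ring.
  rewrite ler_wpM2l ?mulr_ge0 ?exprn_ge0 ?(ltW C0) ?(ltW t0)//.
  rewrite -[leRHS]mul1r ler_pdivlMr//.
  have := subrX1 t m; have := exprn_ge0 m (ltW t0).
  set Q := \sum_(i < m) _; lra.
apply/eqP; rewrite eq_le outer_measure_ge0 andbT; apply/lee_addgt0Pr => e e0.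
rewrite add0e.
have [n0 Hn0] := @exprn_lt_eventually _ t (e / (C / (1 - t)))
  ltac:(lra) ltac:(by rewrite !divr_gt0).
apply: le_trans (bound n0) _; rewrite lee_fin mulrC -ler_pdivlMr ?divr_gt0//.
by rewrite ltW// Hn0.
Qed.

End NullSets.

Section LowerMass.
Context {R : realType} {X : metricType R}.
Implicit Types (mu : {outer_measure set X -> \bar R}).

Definition mass_lower mu (t : R) (x : X) : Prop :=
  exists2 r1 : R, 0 < r1 & forall r, 0 < r < r1 ->
    ((r `^ t)%:E <= mu (cball x r))%E.

(** The mass of the hole is compared with that of a concentric ball, and not of
    the ball about [x], so that the condition on [y] does not involve [x]. *)
Definition has_holes mu (k : nat) (eps : R) (x : X) : Prop :=
  exists2 r1 : R, 0 < r1 & forall r, 0 < r < r1 ->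
    exists2 y : X, mdist x y <= r &
      (mu (cball y (2 * (r / 2 ^+ k))) <= eps%:E * mu (cball y (2 * r)))%E.

Lemma scale_powR (r0 t : R) n : 0 < r0 ->
  (scale r0 n) `^ t = r0 `^ t * 2 `^ (- t * n%:R).
Proof.
move=> r00; rewrite /scale powRM ?invr_ge0 ?exprn_ge0 ?(ltW r00)//; congr (_ * _).
by rewrite -powR_invn// -powRrM mulNr mulrC mulNr.
Qed.

Lemma scale_eventually_le (r0 r : R) : 0 < r0 -> 0 < r -> exists n, scale r0 n <= r.
Proof.
move=> r00 rgt0.
have [n Hn] := @exprn_lt_eventually R (1 / 2) (r / r0) ltac:(lra) ltac:(by rewrite divr_gt0).
exists n; have := Hn n (leqnn n); rewrite ltr_pdivlMr// => /ltW.
by rewrite mul1r exprVn mulrC.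
Qed.

(** The slack between [t0] and [t] absorbs the constant [C] and the loss from
    passing to arbitrary radii. *)
Lemma mass_lower_of_scales mu (r0 C t0 t : R) (x : X) n1 : 0 < r0 -> 0 < C ->
  t0 < t -> 0 <= t ->
  (forall n, (n1 <= n)%N -> ((C * 2 `^ (- t0 * n%:R))%:E <= mu (cball x (scale r0 n)))%E) ->
  mass_lower mu t x.
Proof.
move=> r00 C0 t0t tge0 H.
have K0 : 0 < (2 * r0) `^ t by rewrite powR_gt0// mulr_gt0.
have [n2 Hn2] := @exprn_lt_eventually R (2 `^ (t0 - t)) (C / (2 * r0) `^ t)
  ltac:(by rewrite powR_ge0 pow2_lt1// subr_lt0) ltac:(by rewrite divr_gt0).
exists (scale r0 (maxn n1 n2)); first exact: scale_gt0.
move=> r /andP[rgt0 rlt].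
have exN : exists n, scale r0 n <= r by exact: scale_eventually_le.
case: (ex_minnP exN) => N Nr Nmin.
have Nmax : (maxn n1 n2 < N)%N.
  rewrite ltnNge; apply/negP => /(scale_le r00) /le_trans /(_ Nr).
  by rewrite leNgt rlt.
have rN : r <= 2 * scale r0 N.
  case: N Nr Nmin Nmax => // N _ Nmin _; rewrite scaleS mulrCA divff// mulr1.
  by rewrite ltW// ltNge; apply/negP => /Nmin; rewrite ltnn.
apply: (@le_trans _ _ (mu (cball x (scale r0 N)))); last first.
  by apply: le_outer_measure => y; rewrite /cball/= => /le_trans; apply.
have /H := leq_trans (leq_maxl n1 n2) (ltnW Nmax).
apply: le_trans; rewrite lee_fin.
apply: (@le_trans _ _ ((2 * scale r0 N) `^ t)).
  by apply: ge0_ler_powR => //; rewrite nnegrE ?mulr_ge0// ltW// scale_gt0.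
rewrite powRM ?(ltW (scale_gt0 r00 _))// scale_powR// mulrA -powRM ?(ltW r00)//.
have := Hn2 N (leq_trans (leq_maxr n1 n2) (ltnW Nmax)); rewrite ltr_pdivlMr// pow2X => /ltW.
rewrite (_ : - t * N%:R = - t0 * N%:R + (t0 - t) * N%:R); last by ring.
rewrite pow2D => H1.
rewrite mulrCA mulrC ler_wpM2r ?powR_ge0//.
by rewrite mulrC.
Qed.

End LowerMass.

(** With [g] the masses of the balls of radius [scale r0 i] about a point, this is
    a drop of the mass by the factor [t ^+ L] within [L] levels. *)
Definition jump (R : realType) (g : nat -> R) (t : R) (L i : nat) : bool :=
  (L <= i)%N && (g i <= t ^+ L * g (i - L)%N).

(** Jumps may overlap, but a jump at [N] gains [t ^+ L] over level [N - L], and at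
    most [L] levels are counted in between: on average each counted level is
    worth a factor [t]. *)
Lemma rare_jumps (R : realType) (g : nat -> R) (t : R) (L : nat) (N : nat) : (0 < L)%N ->
  0 < t <= 1 -> (forall n, 0 <= g n) -> (forall n, g n.+1 <= g n) ->
  g N <= t ^+ (\sum_(i < N.+1) jump g t L i)%N * g 0.
Proof.
move=> L0 /andP[t0 t1] g0 gS.
pose bad := jump g t L.
pose c M := (\sum_(i < M) bad i)%N.
rewrite -[X in t ^+ X]/(c N.+1).
have cS M : c M.+1 = (c M + bad M)%N by rewrite /c big_ord_recr.
elim/ltn_ind: N => N IH.
have [bN|nbN] := boolP (bad N); last first.
  case: N => [|N] in IH nbN *.
    by rewrite /c big_ord_recr big_ord0 /= (negPf nbN) mul1r.
  rewrite cS (negPf nbN) addn0; apply: le_trans (gS N) _; exact: IH.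
have /andP[LN gN] := bN.
apply: le_trans gN _.
have cL : (c N.+1 <= L + c (N - L).+1)%N.
  have : forall M i, (c (M + i) <= i + c M)%N.
    by move=> M; elim=> [|i IHi]; rewrite ?addn0// addnS cS; case: (bad _); lia.
  by move=> /(_ (N - L).+1 L); rewrite addSn subnK.
apply: (@le_trans _ _ (t ^+ L * (t ^+ c (N - L).+1 * g 0))).
  by rewrite ler_wpM2l ?exprn_ge0 ?(ltW t0)// IH//; lia.
rewrite mulrA -exprD ler_wpM2r//.
by apply: ler_wiXn2l => //; exact: ltW.
Qed.

(** * Mass lower bounds almost everywhere *)

Lemma outer_null_cballs (R : realType) (X : metricType R)
    (mu : {outer_measure set X -> \bar R}) (o : X) (A : set X) :
  (forall j : nat, mu (cball o j%:R `&` A) = 0%E) -> mu A = 0%E.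
Proof.
move=> H; apply: outer_null_subset (outer_null_bigcup H) => x Ax.
exists (Num.truncn (mdist o x)).+1 => //; split => //.
by rewrite /cball/= ltW// truncnS_gt.
Qed.

Lemma subn_split2 i k : (k.+2 <= i)%N -> (i - k = (i - k.+2).+2)%N.
Proof. lia. Qed.

Lemma level_window k M N : (1 < M)%N -> (M < N.+1 - k)%N ->
  (k + 2 <= M + k <= N)%N.
Proof. lia. Qed.

Lemma ramp_succ M m n :
  (minn M.+1 m - n = minn M m - n + ((n <= M) && (M < m)))%N.
Proof. by case: (boolP (_ && _)) => /=; lia. Qed.

Lemma ramp_ge N k n : (N <= N.+1 - k - n + (k + n))%N.
Proof. lia. Qed.

Lemma rate_mul_le (R : realType) (x e c n : R) : 0 < e -> 0 <= x -> e * n < c ->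
  - (x / e) * c <= - x * n.
Proof.
move=> e0 x0 nc; have H : n <= c / e by rewrite ler_pdivlMr// mulrC ltW.
rewrite !mulNr lerN2 (_ : x / e * c = x * (c / e)); last by ring.
by rewrite ler_wpM2l.
Qed.

Section AlmostEverywhere.
Context {R : realType} {X : metricType R} (s a b r0 : R).
Context (nu mu : {outer_measure set X -> \bar R}).
Context (s_gt0 : 0 < s) (a_gt0 : 0 < a) (b_gt0 : 0 < b) (r0_gt0 : 0 < r0).
Context (reg : regular_with s a b nu) (r0diam : ((6 * r0)%:E <= mdiam X)%E).
Context (mmu : is_metric_measure mu).

(** The points [x] such that every net point [z] close to [x] has a light ball are
    covered by those light balls; the sum of their masses is at most
    [C * (2 `^ (- delta)) ^+ N] by the hypothesis on [w]. *)
Lemma ae_weighted_mass (o : X) (r delta : R) (Z : nat -> seq X)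
    (w : nat -> X -> R) : 0 < delta ->
  (forall N, is_net o r (scale r0 N / 4) (Z N)) ->
  (forall N z, 0 <= w N z) ->
  (forall N, \sum_(z <- Z N) w N z <= \sum_(z <- Z N) 1) ->
  mu [set x | cball o r x /\ ~ exists n0, forall N, (n0 <= N)%N ->
    exists2 z, mdist x z <= scale r0 N / 4 &
      ((w N z * 2 `^ (- (s + delta) * N%:R))%:E <= mu (cball x (scale r0 N)))%E] = 0%E.
Proof.
move=> d0 Znet w0 wsum.
have [C C0 HC] := net_size_le a_gt0 r0_gt0 reg r0diam o r.
pose m N z : R := w N z * 2 `^ (- (s + delta) * N%:R).
pose E N := [set x | cball o r x /\ forall z, z \in Z N -> mdist x z <= scale r0 N / 4 ->
   (mu (cball z (scale r0 N / 4)) <= (m N z)%:E)%E].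
have muE N : (mu (E N) <= (C * (2 `^ (- delta)) ^+ N)%:E)%E.
  pose P z := (mu (cball z (scale r0 N / 4)) <= (m N z)%:E)%E.
  apply: (@le_trans _ _ (\sum_(z <- Z N | P z) mu (cball z (scale r0 N / 4)))%E).
    apply: outer_measure_cover_seq => x [ox Hx].
    have [_ _ /(_ x ox) [z zZ xz]] := Znet N; exists z; split => //.
      by apply: Hx.
    by rewrite /cball/= metric_sym.
  apply: le_trans (_ : \sum_(z <- Z N | P z) (m N z)%:E <= _)%E.
    by apply: lee_sum.
  rewrite sumEFin lee_fin.
  apply: le_trans (_ : \sum_(z <- Z N) m N z <= _).
    rewrite big_mkcond; apply: ler_sum => z _; case: ifP => // _.
    by rewrite mulr_ge0 ?w0 ?powR_ge0.
  rewrite -mulr_suml pow2X.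
  have -> : - (s + delta) * N%:R = - (s * N%:R) + (- delta * N%:R) by ring.
  rewrite pow2D mulrA ler_wpM2r ?powR_ge0// powRN ler_pdivrMr ?pow2_gt0//.
  apply: le_trans (wsum N) _; rewrite -pow2X; exact: HC.
have t01 : 0 < (2 : R) `^ (- delta) < 1.
  by rewrite pow2_gt0 pow2_lt1// oppr_lt0.
apply: outer_null_subset (outer_borel_cantelli C0 t01 muE) => x [ox nH].
apply: contra_not nH => -[n0 Hn0]; exists n0 => N /Hn0 nE.
have [_ _ /(_ x ox) [z0 z0Z xz0]] := Znet N.
apply: contrapT => nz; apply: nE; split => // z zZ xz.
rewrite leNgt; apply/negP => zm; apply: nz; exists z => //.
apply: le_trans (ltW zm) _; apply: le_outer_measure.
by apply: cball_subset; have := scale_gt0 r0_gt0 N; lra.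
Qed.

Lemma ae_mass_lower (delta : R) (o : X) : 0 < delta ->
  mu [set x | ~ mass_lower mu (s + delta) x] = 0%E.
Proof.
move=> d0; apply: (outer_null_cballs (o := o)) => j.
have [Z HZ] := choice (fun N => regular_net_exists a_gt0 r0_gt0 reg r0diam o j%:R N).
have d20 : 0 < delta / 2 by lra.
apply: outer_null_subset (ae_weighted_mass (w := fun _ _ => 1) d20 HZ _ _) => //.
move=> x [ox nx]; split => //; apply: contra_not nx => -[n0 H].
have st : s + delta / 2 < s + delta by lra.
have s0 : 0 <= s + delta by rewrite addr_ge0 ?(ltW s_gt0) ?(ltW d0).
apply: (mass_lower_of_scales (n1 := n0) r0_gt0 ltr01 st s0).
by move=> N /H[z _].
Qed.

Context (k : nat) (beta : R).
Let q := (2 : R) `^ s.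
Let D := b / a * 48 `^ s.
Context (beta_gt0 : 0 < beta) (beta_le1 : beta <= 1) (beta_les : beta <= s).
Context (beta_small : beta * (4 * D ^+ 2 * expR 9 * \sum_(i < k.+1) q ^+ i) <= 1).

Let L := k.+2.
Let eta := beta / 32.
Let theta := (2 : R) `^ (- ((s + 1) / eta)).

(** The truncation to levels at most [N] and to a ball makes all holes visible to
    a net of scale [scale r0 N / 4] in a slightly larger ball. *)
Definition hole_centers (o : X) (r : R) (eps : R) (N m : nat) : set X :=
  [set y | [/\ (k + 2 <= m <= N)%N, cball o r y &
    (mu (cball y (2 * scale r0 m)) <= eps%:E * mu (cball y (2 * scale r0 (m - k))))%E]].

Let ball_mass x n : R := fine (mu (cball x (scale r0 n))).

Lemma cball_fineE x r : mu (cball x r) = (fine (mu (cball x r)))%:E.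
Proof. by rewrite fineK// cball_fin. Qed.

Lemma eta_gt0 : 0 < eta.
Proof. by rewrite divr_gt0. Qed.

Lemma theta01 : 0 < theta <= 1.
Proof.
by rewrite pow2_gt0 ltW// pow2_lt1// oppr_lt0 divr_gt0// ?addr_gt0// eta_gt0.
Qed.

Lemma ball_mass_ge0 x n : 0 <= ball_mass x n.
Proof. by rewrite fine_ge0// outer_measure_ge0. Qed.

Lemma ball_mass_le x n : ball_mass x n.+1 <= ball_mass x n.
Proof.
rewrite -lee_fin -!cball_fineE; apply: le_outer_measure => y.
rewrite /cball/= => /le_trans; apply.
exact: scale_le.
Qed.

(** The ball about [x] of radius [scale r0 i] lies in the hole, and the ball of
    radius [scale r0 (i - L)] contains the ball with which the hole is compared;
    this is why [L] exceeds [k] by two. *)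
Lemma in_hole_jump o r N x i :
  0 < in_hole r0 (hole_centers o r (theta ^+ L) N) i x -> jump (ball_mass x) theta L i.
Proof.
move=> /(cutoff_gt0P (scale_gt0 r0_gt0 i)) [y [/andP[ki iN] _ Hy] xy].
have Li : (L <= i)%N by rewrite /L -addn2.
rewrite /jump Li/=.
rewrite -lee_fin EFinM -!cball_fineE.
apply: (@le_trans _ _ (mu (cball y (2 * scale r0 i)))).
  by apply: le_outer_measure; apply: cball_subset; rewrite metric_sym; lra.
apply: le_trans Hy _; rewrite lee_wpmul2l ?lee_fin ?exprn_ge0 ?powR_ge0//.
apply: le_outer_measure; apply: cball_subset.
have -> : scale r0 (i - L) = 4 * scale r0 (i - k).
  rewrite (subn_split2 Li).
  by rewrite !scaleS; field.
have := scale_le r0_gt0 (leq_subr k i); have := scale_gt0 r0_gt0 i; lra.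
Qed.

(** The choice of [theta] is such that more than [eta * N] jumps would push the
    mass below [2 `^ (- (s + 1) * N)], against the assumed lower bound. *)
Lemma few_jumps x : mass_lower mu (s + 1 / 2) x ->
  exists n0, forall N, (n0 <= N)%N ->
    (\sum_(i < N.+1) jump (ball_mass x) theta L i)%N%:R <= eta * N%:R :> R.
Proof.
move=> [r1 r10 Hr1].
have [n1 Hn1] : exists n, scale r0 n <= r1 / 2 by apply: scale_eventually_le => //; lra.
pose K := r0 `^ (s + 1 / 2).
have K0 : 0 < K by rewrite powR_gt0.
have mass0_ge0 := ball_mass_ge0 x 0.
have [n2 Hn2] := @exprn_lt_eventually R (2 `^ (- (1 / 2))) (K / (ball_mass x 0 + 1))
  ltac:(by rewrite powR_ge0 pow2_lt1//; lra) ltac:(by rewrite divr_gt0//; lra).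
exists (maxn n1 n2) => N; rewrite geq_max => /andP[n1N n2N].
rewrite leNgt; apply/negP => many.
have sN : scale r0 N < r1.
  by have := scale_le r0_gt0 n1N; lra.
have := Hr1 (scale r0 N); rewrite scale_gt0// sN => /(_ isT).
rewrite cball_fineE lee_fin scale_powR// -/(ball_mass x N) -/K => low.
have up := @rare_jumps R (ball_mass x) theta L N isT theta01 (ball_mass_ge0 x) (ball_mass_le x).
have : theta ^+ (\sum_(i < N.+1) jump (ball_mass x) theta L i)%N <= 2 `^ (- (s + 1) * N%:R).
  rewrite pow2X; apply: pow2_le; apply: rate_mul_le many; first exact: eta_gt0.
  by rewrite addr_ge0 ?(ltW s_gt0).
move=> H; have {up}H : ball_mass x N <= 2 `^ (- (s + 1) * N%:R) * ball_mass x 0.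
  by apply: le_trans up _; rewrite ler_wpM2r.
have {low}H := le_trans low H.
have := Hn2 N n2N; rewrite ltNge => /negP; apply.
rewrite ler_pdivrMr; last lra.
move: H; have -> : - (s + 1) * N%:R = - (s + 1 / 2) * N%:R + - (1 / 2) * N%:R by field.
rewrite pow2D mulrC -mulrA ler_pM2l ?pow2_gt0// pow2X => H.
by apply: le_trans H _; rewrite ler_wpM2l ?powR_ge0//; lra.
Qed.

(** From level [n1] on, every factor gains at least [2 `^ (beta / 4)], as long as
    the holes [k] levels deeper have level at most [N], while losses occur
    only at jumps. *)
Lemma weight_lower_bound o (j : R) x N n1 : cball o j x -> (2 <= n1)%N ->
  (forall n, (n1 <= n)%N -> exists2 y, mdist x y <= scale r0 n &
     (mu (cball y (2 * scale r0 (n + k))) <=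
      (theta ^+ L)%:E * mu (cball y (2 * scale r0 n)))%E) ->
  forall M, 2 `^ (beta / 4 * (minn M (N.+1 - k) - n1)%N%:R -
     (\sum_(i < M) jump (ball_mass x) theta L i)%N%:R) <=
   weight r0 k beta (hole_centers o (j + r0) (theta ^+ L) N) M x.
Proof.
move=> ox n12 holes; set V := hole_centers _ _ _ _.
have bpos := beta_gt0; have b1 := beta_le1.
have b01 : 0 <= beta <= 1 by rewrite ltW.
elim=> [|M IH].
  by rewrite big_ord0 /weight big_ord0 min0n sub0n mulr0 subr0 powRr0.
rewrite weightS big_ord_recr/=.
have /andP[v0 v1] := in_hole01 V r0_gt0 M x.
have /andP[u0 u1] := near_hole01 k V r0_gt0 M x.
set c : nat := (\sum_(i < M) _)%N in IH *.
have v_le : 2 `^ (- (jump (ball_mass x) theta L M)%:R) <= 1 - in_hole r0 V M x / 2.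
  have [vpos|vneg] := ltP 0 (in_hole r0 V M x).
    rewrite (in_hole_jump vpos) pow2N1; lra.
  have -> : in_hole r0 V M x = 0 by apply/eqP; rewrite eq_le v0 vneg.
  rewrite mul0r subr0; apply: pow2_le1; rewrite oppr_le0; exact: ler0n.
have u_le : 2 `^ (beta / 4 * ((n1 <= M) && (M < N.+1 - k))%N%:R) <=
    1 + beta * near_hole r0 k V M x.
  case: (boolP (_ && _)) => [/andP[n1M MN]|_]; last first.
    by rewrite mulr0 powRr0 lerDl mulr_ge0// ltW.
  rewrite mulr1; apply: le_trans (pow2_le1D _) _; first lra.
  have [y xy Hy] := holes M n1M.
  suff : 1 / 2 <= near_hole r0 k V M x by nra.
  apply: (@cutoff_half _ _ _ _ _ y); first by rewrite mulr_gt0 ?scale_gt0.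
    split; [exact: level_window (leq_trans n12 n1M) MN| |by rewrite addnK].
    have := metric_triangle o x y; have := scale_le0 r0_gt0 M.
    by move: ox; rewrite /cball/=; lra.
  by have := scale_gt0 r0_gt0 M; lra.
rewrite [X in 2 `^ X <= _](_ : _ = (beta / 4 * (minn M (N.+1 - k) - n1)%N%:R - c%:R) +
   (beta / 4 * ((n1 <= M) && (M < N.+1 - k))%N%:R + - (jump (ball_mass x) theta L M)%:R)); last first.
  have -> : (minn M.+1 (N.+1 - k) - n1 =
    minn M (N.+1 - k) - n1 + ((n1 <= M) && (M < N.+1 - k)))%N by exact: ramp_succ.
  by rewrite !natrD; ring.
rewrite pow2D; apply: ler_pM; rewrite ?powR_ge0//.
by rewrite pow2D; apply: ler_pM; rewrite ?powR_ge0.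
Qed.

(** The gain [beta / 4] per level exceeds the losses, [eta = beta / 32] from the
    jumps and [eta] from the Borel-Cantelli argument, by [3 * beta / 16]. *)
Lemma mass_lower_of_holes o (j : R) x : cball o j x ->
  mass_lower mu (s + 1 / 2) x -> has_holes mu k (theta ^+ L) x ->
  (exists n0, forall N, (n0 <= N)%N -> exists2 z, mdist x z <= scale r0 N / 4 &
    ((weight r0 k beta (hole_centers o (j + r0) (theta ^+ L) N) N.+1 z *
      2 `^ (- (s + eta) * N%:R))%:E <= mu (cball x (scale r0 N)))%E) ->
  mass_lower mu (s - beta / 8) x.
Proof.
move=> ox lowx [r1 r10 Hr1] [n0 Hn0].
have bs := beta_les; have bpos := beta_gt0.
have b01 : 0 <= beta <= 1 by rewrite ltW.
have [n2 Hn2] := few_jumps lowx.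
have [n3 Hn3] : exists n, scale r0 n <= r1 / 2 by apply: scale_eventually_le => //; lra.
pose n1 := maxn 2 n3.
have holes n : (n1 <= n)%N -> exists2 y, mdist x y <= scale r0 n &
     (mu (cball y (2 * scale r0 (n + k))) <=
      (theta ^+ L)%:E * mu (cball y (2 * scale r0 n)))%E.
  rewrite geq_max => /andP[_ /(scale_le r0_gt0) sn].
  have [|y xy Hy] := Hr1 (scale r0 n); first by rewrite scale_gt0//=; lra.
  exists y => //; apply: le_trans Hy; rewrite le_eqVlt; apply/orP; left; apply/eqP.
  congr (mu (cball y _)); rewrite /scale exprD; field.
  by rewrite !expf_eq0 !gt_eqF// !andbF.
pose C := expR (-1) * 2 `^ (- (beta / 4) * (k + n1)%N%:R) : R.
have C0 : 0 < C by rewrite mulr_gt0 ?expR_gt0 ?pow2_gt0.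
have t0t : s - 3 * beta / 16 < s - beta / 8 by lra.
have t0 : 0 <= s - beta / 8 by lra.
apply: (mass_lower_of_scales (n1 := maxn n0 n2) r0_gt0 C0 t0t t0) => N.
rewrite geq_max => /andP[n0N n2N]; have [z xz Hz] := Hn0 N n0N.
apply: le_trans Hz; rewrite lee_fin.
have few := Hn2 N n2N.
have := weight_lower_bound N ox (leq_maxl 2 n3) holes N.+1.
set V := hole_centers _ _ _ _; set c := (\sum_(i < N.+1) _)%N in few *.
rewrite (minn_idPr (leq_subr k N.+1)).
move=> wx.
have {}wx : 2 `^ (beta / 4 * (N%:R - (k + n1)%N%:R) - eta * N%:R) <= weight r0 k beta V N.+1 x.
  apply: le_trans wx; apply: pow2_le; apply: lerB => //.
  rewrite ler_wpM2l//; first lra.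
  rewrite lerBlDr -natrD ler_nat; exact: ramp_ge.
have wz : expR (-1) * weight r0 k beta V N.+1 x <= weight r0 k beta V N.+1 z.
  rewrite expRN mulrC ler_pdivrMr ?expR_gt0//.
  apply: le_trans (weight_comparable k V r0_gt0 b01 N.+1 x z) _.
  rewrite ler_wpM2l ?weight_ge0// ler_expR scaleS ler_pdivrMr ?mul1r; last first.
    by rewrite divr_gt0 ?scale_gt0.
  lra.
apply: le_trans (_ : expR (-1) * 2 `^ (beta / 4 * (N%:R - (k + n1)%N%:R) - eta * N%:R) *
   2 `^ (- (s + eta) * N%:R) <= _).
  rewrite /C -!mulrA -!pow2D ler_wpM2l ?expR_ge0//; apply: pow2_le.
  rewrite le_eqVlt; apply/orP; left; apply/eqP.
  by rewrite /eta; field.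
rewrite ler_wpM2r ?powR_ge0//; apply: le_trans wz.
by rewrite ler_wpM2l ?expR_ge0.
Qed.

Lemma ae_mass_lower_of_holes (o : X) :
  mu [set x | ~ (has_holes mu k (theta ^+ L) x -> mass_lower mu (s - beta / 8) x)] = 0%E.
Proof.
apply: (outer_null_cballs (o := o)) => j.
have b01 : 0 <= beta <= 1 by rewrite ltW.
pose r := j%:R + r0 + r0; have r0pos := r0_gt0.
have [Z HZ] := choice (fun N => regular_net_exists a_gt0 r0_gt0 reg r0diam o r N).
have eta0 := eta_gt0; have s0 := s_gt0.
pose V N := hole_centers o (j%:R + r0) (theta ^+ L) N.
have D0 : 0 < D by rewrite mulr_gt0 ?divr_gt0// powR_gt0.
have q1 : 1 <= q by exact/pow2_ge1/ltW.
have wsum N : \sum_(z <- Z N) weight r0 k beta (V N) N.+1 z <= \sum_(z <- Z N) 1.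
  have [_ sepZ _] := HZ N.
  apply: (weight_sum_le r0_gt0 b01 D0 q1 _ _ _ beta_small).
  - by move=> m y [/andP[_ mN] _ _].
  - by move=> n z' nN; exact: (net_count_le a_gt0 r0_gt0 reg r0diam).
  - move=> m y [/andP[_ mN] oy _].
    apply: (net_count_ge s_gt0 a_gt0 b_gt0 r0_gt0 reg r0diam mN (HZ N)).
    apply: cball_subset; move: oy; rewrite /cball/= /r; have := scale_le0 r0_gt0 m; lra.
have w0 N z : 0 <= weight r0 k beta (V N) N.+1 z by exact: weight_ge0.
have half0 : 0 < 1 / 2 :> R by lra.
apply: outer_null_subset (outer_null_setU (ae_weighted_mass eta0 HZ w0 wsum)
  (ae_mass_lower o half0)) => x [ox nx].
have [lowx|] := pselect (mass_lower mu (s + 1 / 2) x); last by right.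
left; split; first by move: ox; rewrite /cball/= /r; lra.
move=> H; apply: nx => holes; exact: mass_lower_of_holes ox lowx holes H.
Qed.

End AlmostEverywhere.

(** * From porosity to holes, and from mass bounds to the dimension *)

Lemma powR_invr (R : realType) (x s : R) : 0 <= x -> x^-1 `^ s = (x `^ s)^-1.
Proof. by move=> x0; rewrite -powR_inv1// -powRrM mulrC powRrM powR_inv1 ?powR_ge0. Qed.

Section Pointwise.
Context {R : realType} {X : metricType R} (mu : {outer_measure set X -> \bar R}).
Context (mmu : is_metric_measure mu).

Lemma upper_local_dim_le (t : R) (x : X) : mass_lower mu t x ->
  (upper_local_dim mu x <= t%:E)%E.
Proof.
move=> [r1 r10 Hr1]; rewrite /upper_local_dim limf_esupE.
have V : (0 : R)^'+ [set r | 0 < r < Num.min r1 1].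
  have m0 : 0 < Num.min r1 1 by rewrite lt_min r10 ltr01.
  near=> r; apply/andP; split.
    by near: r; exact: nbhs_right_gt.
  by near: r; exact: nbhs_right_lt.
apply: (@le_trans _ _ (ereal_sup ((fun r : R => lne (mu (cball x r)) * ((ln r)^-1)%:E)%E @`
    [set r | 0 < r < Num.min r1 1]))).
  by apply: ereal_inf_lbound; exists [set r | 0 < r < Num.min r1 1].
apply: ge_ereal_sup => _ [r /andP[r0 rm1] <-].
move: rm1; rewrite lt_min => /andP[rr1 r_lt1].
have := Hr1 r; rewrite r0 rr1 => /(_ isT).
have /fineK <- := cball_fin x r mmu; set m := fine _; rewrite lee_fin => rm.
have rt0 : 0 < r `^ t by rewrite powR_gt0.
have m0 : 0 < m by exact: lt_le_trans rm.
rewrite lne_EFin// -EFinM lee_fin.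
have lnr : ln r < 0 by rewrite ln_lt0// r0.
by rewrite ler_ndivrMr// -ln_powR ler_ln ?posrE.
Unshelve. all: by end_near. Qed.

(** The set whose supremum is [por1_at]. *)
Definition hole_radii (x : X) (r eps : R) : set R := [set rho : R | 0 <= rho /\
  exists y : X, (mu (cball y (rho * r)) <= eps%:E * mu (cball x r))%E /\
                rho * r + mdist x y <= r].

Lemma hole_radii_ub x r eps : 0 < r -> ubound (hole_radii x r eps) 1.
Proof.
move=> r0 rho [rho0 [y [_ H]]]; have := mdist_ge0 x y.
by move=> d0; rewrite -(ler_pM2r r0); lra.
Qed.

Lemma por1_at_ge0 x r eps : 0 < r -> 0 <= por1_at mu x r eps.
Proof.
move=> r0; rewrite /por1_at -/(hole_radii x r eps).
have [->|/set0P[rho H]] := eqVneq (hole_radii x r eps) set0; first by rewrite sup0.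
apply: le_trans (_ : rho <= _); first by case: H.
by apply: ub_le_sup => //; exists 1; exact: hole_radii_ub.
Qed.

Lemma por1_at_le1 x r eps : 0 < r -> por1_at mu x r eps <= 1.
Proof.
move=> r0; rewrite /por1_at -/(hole_radii x r eps).
have [->|/set0P[rho H]] := eqVneq (hole_radii x r eps) set0; first by rewrite sup0.
by apply: ge_sup; [exists rho|exact: hole_radii_ub].
Qed.

Lemma por1_at_le x r eps eps' : 0 < r -> eps <= eps' ->
  por1_at mu x r eps <= por1_at mu x r eps'.
Proof.
move=> r0 ee'; have := por1_at_ge0 x eps' r0.
rewrite /por1_at -/(hole_radii x r eps) -/(hole_radii x r eps').
have [->|/set0P[rho0 H]] := eqVneq (hole_radii x r eps) set0; first by rewrite sup0.
move=> _; have sub : hole_radii x r eps `<=` hole_radii x r eps'.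
  move=> rho [rho_ge0 [y [Hy Hxy]]]; split => //; exists y; split => //.
  apply: le_trans Hy _; apply: lee_wpmul2r; first exact: outer_measure_ge0.
  by rewrite lee_fin.
apply: ge_sup; first by exists rho0.
move=> rho /sub H'; apply: ub_le_sup => //; exists 1; exact: hole_radii_ub.
Qed.

Definition lower_por (x : X) (eps : R) : \bar R :=
  limf_einf (fun r : R => (por1_at mu x r eps)%:E) 0^'+.

Lemma pos_right : (0 : R)^'+ [set r | 0 < r].
Proof. exact: nbhs_right_gt. Qed.

Lemma lower_por_ge0 x eps : (0 <= lower_por x eps)%E.
Proof.
rewrite /lower_por limf_einfE.
apply: (@le_trans _ _ (ereal_inf ((fun r : R => (por1_at mu x r eps)%:E) @` [set r | 0 < r]))).
  by apply: le_ereal_inf_tmp => _ [r r0 <-]; rewrite lee_fin por1_at_ge0.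
by apply: ereal_sup_ubound; exists [set r | 0 < r] => //; exact: pos_right.
Qed.

Lemma lower_por_le1 x eps : (lower_por x eps <= 1)%E.
Proof.
rewrite /lower_por limf_einfE; apply: ge_ereal_sup => _ [V FV <-].
have [r [Vr r0]] : (V `&` [set r | 0 < r]) !=set0.
  by apply: (@filter_ex _ (0 : R)^'+); apply: filterI => //; exact: pos_right.
apply: (@le_trans _ _ (por1_at mu x r eps)%:E).
  by apply: ereal_inf_lbound; exists r.
by rewrite lee_fin por1_at_le1.
Qed.

Lemma lower_por_le x eps eps' : eps <= eps' -> (lower_por x eps <= lower_por x eps')%E.
Proof.
move=> ee'; rewrite /lower_por !limf_einfE; apply: ge_ereal_sup => _ [V FV <-].
apply: (@le_trans _ _ (ereal_inf ((fun r : R => (por1_at mu x r eps')%:E) @`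
   (V `&` [set r | 0 < r])))).
  apply: le_ereal_inf_tmp => _ [r [Vr r0] <-].
  apply: (@le_trans _ _ (por1_at mu x r eps)%:E).
    by apply: ereal_inf_lbound; exists r.
  by rewrite lee_fin por1_at_le.
apply: ereal_sup_ubound; exists (V `&` [set r | 0 < r]) => //.
by apply: filterI => //; exact: pos_right.
Qed.

(** The porosity increases with [eps], so its limit at [0] is an infimum. *)
Lemma por1E x : por1 mu x = ereal_inf (lower_por x @` [set e | 0 < e]).
Proof.
have -> : [set e : R | 0 < e] = [set` `]0, +oo[].
  by apply/seteqP; split => e /=; rewrite in_itv/= andbT.
apply/cvg_lim; first exact: ereal_hausdorff.
apply: nondecreasing_at_right_cvge; first by [].
by move=> e e' _ _; exact: lower_por_le.
Qed.

Lemma por1_ge0 x : (0 <= por1 mu x)%E.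
Proof.
by rewrite por1E; apply: le_ereal_inf_tmp => _ [e _ <-]; exact: lower_por_ge0.
Qed.

Lemma por1_le x eps : 0 < eps -> (por1 mu x <= lower_por x eps)%E.
Proof. by move=> e0; rewrite por1E; apply: ereal_inf_lbound; exists eps. Qed.

Lemma por1_has_holes (p : R) x k eps : (p%:E < por1 mu x)%E -> 0 <= p -> 0 < eps ->
  2 / 2 ^+ k <= p -> has_holes mu k eps x.
Proof.
move=> pP p0 e0 kp; have := lt_le_trans pP (por1_le x e0).
rewrite /lower_por limf_einfE => /ereal_sup_gt[_ [V [r1 /= r10 HV] <-] pV].
exists r1 => // r /andP[r0 rr1].
have Vr : V r by apply: HV => //=; rewrite sub0r normrN gtr0_norm.
have : p < por1_at mu x r eps.
  by rewrite -lte_fin; apply: lt_le_trans pV _; apply: ereal_inf_lbound; exists r.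
rewrite /por1_at -/(hole_radii x r eps).
have [->|/set0P ne] := eqVneq (hole_radii x r eps) set0; first by rewrite sup0 ltNge p0.
move=> /(sup_gt ne)[rho [rho0 [y [Hy Hxy]]] prho].
have rr0 : 0 <= rho * r by rewrite mulr_ge0// ltW.
have dxy : mdist x y <= r by lra.
exists y => //; apply: le_trans (_ : mu (cball y (rho * r)) <= _)%E.
  apply: le_outer_measure; apply: cball_subset; rewrite mdistxx add0r.
  rewrite (_ : 2 * (r / 2 ^+ k) = 2 / 2 ^+ k * r); last by ring.
  rewrite ler_wpM2r ?(ltW r0)//.
  exact: le_trans kp (ltW prho).
apply: le_trans Hy _; rewrite lee_wpmul2l ?lee_fin ?(ltW e0)//.
by apply: le_outer_measure; apply: cball_subset; rewrite metric_sym; lra.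
Qed.

(** These are the two properties needed of a dyadic scale: holes of porosity above
    [p / 2] contain those of relative size [2 / 2 ^+ k], and the scale is not much
    smaller than [p]. *)
Lemma dyadic_between (p : R) : 0 < p <= 1 -> exists k : nat,
  2 / 2 ^+ k <= p / 2 /\ p / 8 < 1 / 2 ^+ k.
Proof.
move=> /andP[p0 p1].
have exk : exists k, scale 2 k <= p / 2 by apply: scale_eventually_le => //; lra.
case: (ex_minnP exk) => -[|k] kp kmin.
  by move: kp; rewrite /scale expr0 divr1; lra.
exists k.+1; split => //.
have : p / 2 < scale 2 k by rewrite ltNge; apply/negP => /kmin; rewrite ltnn.
have -> : 1 / 2 ^+ k.+1 = scale 2 k / 4 :> R.
  rewrite /scale exprS; field; by rewrite expf_eq0 gt_eqF ?andbF.
by lra.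
Qed.

Lemma dim_le_of_holes (s c : R) (eps : nat -> R) x : 0 < s -> 0 < c ->
  (forall k, 0 < eps k) ->
  (forall j : nat, mass_lower mu (s + j.+1%:R^-1) x) ->
  (forall k, has_holes mu k (eps k) x -> mass_lower mu (s - c / (2 `^ s) ^+ k) x) ->
  (upper_local_dim mu x <= s%:E - (c / 8 `^ s)%:E * por1 mu x `^ s)%E.
Proof.
move=> s0 c0 e0 low holes.
have dim_s : (upper_local_dim mu x <= s%:E)%E.
  apply/lee_addgt0Pr => e epos.
  have [j Hj] : exists j : nat, j.+1%:R^-1 <= e.
    exists (Num.truncn e^-1); rewrite -[leRHS]invrK lef_pV2 ?posrE ?invr_gt0//.
    by rewrite ltW// truncnS_gt.
  apply: le_trans (upper_local_dim_le (low j)) _.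
  by rewrite -EFinD lee_fin lerD2l.
have := por1_ge0 x; have := le_trans (por1_le x (e0 0%N)) (lower_por_le1 x _).
have := @por1_has_holes ^~ x; case: (por1 mu x) => [p||]//=.
rewrite !lee_fin => Hholes p1; rewrite le_eqVlt => /predU1P[<-|p0].
  by rewrite powR0 ?gt_eqF// mulr0 oppr0 adde0.
have [k [kp pk]] := @dyadic_between p ltac:(by rewrite p0).
have /holes/upper_local_dim_le : has_holes mu k (eps k) x.
  by apply: (Hholes (p / 2)) => //; [rewrite lte_fin|]; lra.
move/le_trans; apply; rewrite -EFinD lee_fin lerD2l lerN2.
rewrite -mulrA ler_pM2l// mulrC.
have -> : p `^ s / 8 `^ s = (p / 8) `^ s.
  by rewrite powRM ?invr_ge0 ?(ltW p0)// powR_invr.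
have -> : ((2 : R) `^ s ^+ k)^-1 = (1 / 2 ^+ k) `^ s.
  by rewrite -exprn_powR div1r powR_invr ?exprn_ge0.
apply: ge0_ler_powR; rewrite ?nnegrE ?(ltW s0)//; first lra.
exact: ltW.
Qed.

End Pointwise.

(** * One-point spaces and the choice of constants *)

Lemma geometric_sum_le (R : realType) (q : R) k : 1 < q ->
  \sum_(i < k.+1) q ^+ i <= q / (q - 1) * q ^+ k.
Proof.
move=> q1; have := subrX1 q k.+1; set S := \sum_(i < k.+1) _ => H.
have q10 : 0 < q - 1 by lra.
rewrite mulrAC -exprS ler_pdivlMr// mulrC -H; lra.
Qed.

(** In a one-point space the regularity condition is void, as no positive radius
    is at most the diameter; the point is an atom. *)
Lemma mass_lower_of_degenerate (R : realType) (X : metricType R)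
    (mu : {outer_measure set X -> \bar R}) (t : R) (x : X) :
  is_metric_measure mu -> (forall y z : X, mdist y z = 0) -> 0 < t ->
  mass_lower mu t x.
Proof.
move=> mmu d0 t0.
have ballT r : 0 <= r -> cball x r = setT.
  by move=> r0; apply/seteqP; split => // y _; rewrite /cball/= d0.
have /fineK mT : mu setT \is a fin_num by rewrite -(ballT 0)// cball_fin.
have := mm_nontrivial mmu; rewrite -mT lte_fin; set M := fine _ => M0.
exists (M `^ t^-1); first by rewrite powR_gt0.
move=> r /andP[r0 rM]; rewrite ballT ?(ltW r0)// -mT lee_fin -/M.
rewrite -[leRHS](powRr1 (ltW M0)) -(mulVf (lt0r_neq0 t0)) powRrM.
by apply: ge0_ler_powR; rewrite ?nnegrE ?powR_ge0 ?ltW.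
Qed.

Lemma no_holes_of_degenerate (R : realType) (X : metricType R)
    (mu : {outer_measure set X -> \bar R}) (k : nat) (eps : R) (x : X) :
  is_metric_measure mu -> (forall y z : X, mdist y z = 0) -> 0 < eps < 1 ->
  ~ has_holes mu k eps x.
Proof.
move=> mmu d0 /andP[e0 e1] [r1 r10 /(_ (r1 / 2))].
have -> : 0 < r1 / 2 < r1 by lra.
move=> /(_ isT)[y _].
have ballT r : 0 <= r -> cball y r = setT.
  by move=> r0; apply/seteqP; split => // z _; rewrite /cball/= d0.
have h0 : 0 <= r1 / 2 by lra.
rewrite !ballT ?mulr_ge0 ?divr_ge0 ?exprn_ge0 ?(ltW r10)//.
have /fineK mT : mu setT \is a fin_num by rewrite -(ballT 0)// cball_fin.
have := mm_nontrivial mmu; rewrite -mT lte_fin; set M := fine _ => M0.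
rewrite -EFinM lee_fin ler_pMl// => /le_lt_trans /(_ e1); by rewrite ltxx.
Qed.

Lemma scale_exists (R : realType) (X : metricType R) :
  (forall y z : X, mdist y z = 0) \/ exists2 r0 : R, 0 < r0 & ((6 * r0)%:E <= mdiam X)%E.
Proof.
have [H|] := pselect (forall y z : X, mdist y z = 0); first by left.
move=> /existsNP[y /existsNP[z /eqP yz]]; right.
have d0 : 0 < mdist y z by rewrite lt_neqAle eq_sym yz mdist_ge0.
exists (mdist y z / 6); first by rewrite divr_gt0.
rewrite (_ : 6 * _ = mdist y z); last by field.
by apply: ereal_sup_ubound; exists y, z.
Qed.

Local Open Scope ereal_scope.

Theorem theorem4p7 (R : realType) (s a b : R) (s_gt0 : (0 < s)%R)
    (a_gt0 : (0 < a)%R) (b_gt0 : (0 < b)%R) :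
  exists2 c : R, (0 < c)%R &
    forall (X : metricType R) (nu mu : {outer_measure set X -> \bar R}),
      regular_with s a b nu -> is_metric_measure mu ->
      mu [set x | ~ (upper_local_dim mu x <= s%:E - c%:E * por1 mu x `^ s)] = 0.
Proof.
pose q : R := (2 `^ s)%R; pose D : R := (b / a * 48 `^ s)%R.
have q_gt1 : (1 < q)%R.
  rewrite /q /powR pnatr_eq0/= expR_gt1 mulr_gt0// ln_gt0//.
  by rewrite ltr1n.
have q0 : (0 < q)%R by lra.
have D0 : (0 < D)%R by rewrite mulr_gt0 ?divr_gt0// powR_gt0.
have A0 : (0 < 4 * D ^+ 2 * expR 9)%R.
  by rewrite mulr_gt0 ?expR_gt0// mulr_gt0// exprn_gt0.
pose K : R := (4 * D ^+ 2 * expR 9 * (q / (q - 1)))%R.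
have K0 : (0 < K)%R.
  by rewrite mulr_gt0// divr_gt0// subr_gt0.
(* The bounds by [1] and [s] keep [beta k] below [1] and the exponents
   [s - beta k / 8] nonnegative. *)
pose c1 : R := Num.min (Num.min 1 s)%R (K^-1)%R.
have c10 : (0 < c1)%R by rewrite !lt_min ltr01 s_gt0 invr_gt0.
have [c1_le1 c1_les c1_leK] : [/\ (c1 <= 1)%R, (c1 <= s)%R & (c1 * K <= 1)%R].
  have : (c1 <= c1)%R by [].
  rewrite {2}/c1 !le_min => /andP[/andP[-> ->] H]; split => //.
  by rewrite -ler_pdivlMr// div1r.
pose beta (k : nat) : R := (c1 / q ^+ k)%R.
have qk1 k : (1 <= q ^+ k)%R by rewrite exprn_ege1// ltW.
have qk0 k : (0 < q ^+ k)%R by rewrite exprn_gt0.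
have beta0 k : (0 < beta k)%R by rewrite divr_gt0.
have beta_c1 k : (beta k <= c1)%R by rewrite ler_pdivrMr// ler_peMr ?(ltW c10).
have beta_small k :
    (beta k * (4 * D ^+ 2 * expR 9 * \sum_(i < k.+1) q ^+ i) <= 1)%R.
  apply: le_trans c1_leK.
  apply: (@le_trans _ _ (beta k * (4 * D ^+ 2 * expR 9 * (q / (q - 1) * q ^+ k))))%R.
    apply: ler_wpM2l; first exact: ltW.
    apply: ler_wpM2l; last exact: geometric_sum_le.
    exact: ltW.
  rewrite /beta /K le_eqVlt; apply/orP; left; apply/eqP.
  by field; rewrite !gt_eqF// subr_gt0.
pose eps (k : nat) : R := (((2 : R) `^ (- ((s + 1) / (beta k / 32)))) ^+ k.+2)%R.
have epsP k : (0 < eps k < 1)%R.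
  have t01 : (0 < (2 : R) `^ (- ((s + 1) / (beta k / 32))) < 1)%R.
    rewrite pow2_gt0/=; apply: pow2_lt1.
    by rewrite oppr_lt0 divr_gt0 ?divr_gt0 ?addr_gt0.
  move: t01 => /andP[t0 t1]; rewrite exprn_gt0//=.
  by rewrite exprn_ilt1// ltW.
(* One factor [8] comes from the loss [beta k / 8] in the exponent, the other
   from rounding the porosity to a dyadic scale. *)
exists (c1 / 8 / 8 `^ s)%R; first by rewrite !divr_gt0// powR_gt0.
move=> X nu mu reg mmu.
have c180 : (0 < c1 / 8)%R by rewrite divr_gt0.
have eps0 k : (0 < eps k)%R by case/andP: (epsP k).
have betaE k : (c1 / 8 / q ^+ k = beta k / 8)%R.
  by rewrite /beta; field; rewrite gt_eqF.
have [d0|[r0 r00 r0diam]] := scale_exists X.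
  rewrite (_ : [set x | _] = set0) ?outer_measure0//.
  apply/seteqP; split => // x /=; apply.
  apply: (dim_le_of_holes mmu s_gt0 c180 eps0) => [j|k].
    by apply: mass_lower_of_degenerate => //; rewrite addr_gt0 ?invr_gt0.
  by move=> /(no_holes_of_degenerate mmu d0 (epsP k)).
have [x0 _] : exists x : X, True.
  apply: contrapT => /forallNP H.
  have := mm_nontrivial mmu; rewrite (_ : setT = set0) ?outer_measure0 ?ltxx//.
  by apply/seteqP; split => // x _; case: (H x).
have null1 (j : nat) : mu [set x | ~ mass_lower mu (s + j.+1%:R^-1)%R x] = 0.
  by apply: (ae_mass_lower mu s_gt0 a_gt0 r00 reg r0diam x0); rewrite invr_gt0.
have null2 (k : nat) : mu [set x | ~ (has_holes mu k (eps k) x ->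
    mass_lower mu (s - beta k / 8)%R x)] = 0.
  apply: (ae_mass_lower_of_holes s_gt0 a_gt0 b_gt0 r00 reg r0diam mmu (beta0 k) _ _ (beta_small k) x0).
    exact: le_trans (beta_c1 k) _.
  exact: le_trans (beta_c1 k) _.
apply: outer_null_subset (outer_null_setU (outer_null_bigcup null1)
  (outer_null_bigcup null2)) => x nx.
apply: contrapT => /not_orP[n1 n2]; apply: nx.
apply: (dim_le_of_holes mmu s_gt0 c180 eps0) => [j|k].
  by apply: contrapT => H; apply: n1; exists j.
rewrite betaE => H; apply: contrapT => H'; apply: n2; exists k => //= /(_ H).
exact: H'.
Qed.
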